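(* The two-component alternating link $12^2_{Jab}$ of $12$ crossings, given by the Conway symbol $9^*.2:.2:.2$, can be reduced to the Hopf link by $4$-moves.
   Context: Links are unoriented links in $S^3$, considered up to ambient isotopy. A $4$-move on a link is a local modification which replaces, inside a ball, two parallel untwisted strands (the trivial $2$-tangle consisting of two parallel arcs, no crossings) by the same two strands twisted about each other by four half-twists of the same handedness; right-handed and left-handed versions and inverses are allowed. A link $L$ can be reduced by $4$-moves to a link $L'$ if $L'$ is obtained from $L$ by a finite sequence of $4$-moves, their inverses, and ambient isotopies. The link $12^2_{Jab}$ is the alternating two-component link with Conway symbol $9^*.2:.2:.2$. Here $9^*$ is Conway's basic polyhedron with nine vertices (with Conway's standard ordering of vertices), and the symbol means that the integer tangle $2$ (two crossings in a row) is substituted in the vertices number $2$, $5$ and $8$, while a single crossing (tangle $1$) is substituted in each of the remaining six vertices. This link is denoted $L12a_{1388}$ in the link tables used by SnapPy (Hoste--Thistlethwaite table). *)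

(* Defs.v *)
From Stdlib Require Export Relation_Operators.
From mathcomp Require Export all_boot all_order all_algebra.
From mathcomp Require Export all_classical all_reals all_analysis.

Set Implicit Arguments.
Unset Strict Implicit.
Unset Printing Implicit Defensive.

Import Order.TTheory GRing.Theory Num.Theory.
Import numFieldNormedType.Exports.

Local Open Scope classical_set_scope.
Local Open Scope ring_scope.

Notation R3 R := (R * R * R)%type.
Notation S3 R := (one_point_compactification (R3 R)).

Definition homeomorphism (T : topologicalType) (f : T -> T) : Prop :=
  continuous f /\ exists g : T -> T, [/\ continuous g, cancel f g & cancel g f].

(* H (t, x) is the position at time t of the point x. *)
Definition ambient_isotopy (R : realType) (T : topologicalType)
    (H : R * T -> T) : Prop :=
  [/\ {within `[0, 1] `*` [set: T], continuous H},
      forall t : R, t \in `[0, 1] -> homeomorphism (fun x => H (t, x)) &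
      forall x, H (0, x) = x].

Definition ambient_isotopic (R : realType) (L L' : set (S3 R)) : Prop :=
  exists2 H : R * S3 R -> S3 R,
    ambient_isotopy H & (fun x => H (1, x)) @` L = L'.

Definition pt (R : realType) (x y z : int) : R3 R :=
  (x%:~R, y%:~R, z%:~R).

Definition segment (R : realType) (a b : R3 R) : set (R3 R) :=
  [set ((1 - t) * a.1.1 + t * b.1.1,
        (1 - t) * a.1.2 + t * b.1.2,
        (1 - t) * a.2 + t * b.2) | t in `[0, 1]].

Fixpoint polyline (R : realType) (s : seq (R3 R)) : set (R3 R) :=
  if s is a :: s' then
    if s' is b :: _ then segment a b `|` polyline s' else [set a]
  else set0.

(* The powers of the imaginary unit: quarter m is i ^ m in the plane. *)
Definition quarter (m : int) : int * int :=
  match absz (m %% 4)%Z with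
  | 0 => (1, 0)
  | 1 => (0, 1)
  | 2 => (-1, 0)
  | _ => (0, -1)
  end.

(* A polygonal helix from height 0 to height 8 that starts at i ^ e and makes
   c quarter turns per unit of height. *)
Definition helix (R : realType) (c e : int) : set (R3 R) :=
  polyline [seq pt R (quarter (c * j%:Z + e)).1 (quarter (c * j%:Z + e)).2 j
           | j <- iota 0 9].
Arguments helix : clear implicits.

(* Two antipodal helices. They are two parallel straight strands for c = 0;
   for c = 1 and c = -1 they wind around each other by eight quarter turns,
   i.e. four half twists, in the two opposite directions. *)
Definition twist_tangle (R : realType) (c : int) : set (R3 R) :=
  helix R c 0 `|` helix R c 2.
Arguments twist_tangle : clear implicits.

(* The ball [-2, 2] x [-2, 2] x [0, 8] containing these tangles. *)
Definition tangle_ball (R : realType) : set (R3 R) :=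
  [set p | [/\ -2 <= p.1.1 <= 2, -2 <= p.1.2 <= 2 & 0 <= p.2 <= 8]].
Arguments tangle_ball : clear implicits.

(* The homeomorphism h carries the ball in which the move takes place to
   tangle_ball. It may reverse the orientation, which only exchanges the two
   handednesses c = 1 and c = -1; both are allowed. *)
Definition four_move (R : realType) (L L' : set (S3 R)) : Prop :=
  exists2 c : int, c = 1 \/ c = -1 &
  exists2 h : S3 R -> S3 R, homeomorphism h &
    [/\ (h @` L) `&` (Some @` tangle_ball R) = Some @` twist_tangle R 0,
        (h @` L') `&` (Some @` tangle_ball R) = Some @` twist_tangle R c &
        (h @` L) `\` (Some @` tangle_ball R) =
        (h @` L') `\` (Some @` tangle_ball R)].

Definition reducible_by_four_moves (R : realType) :
    set (S3 R) -> set (S3 R) -> Prop :=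
  clos_refl_trans (set (S3 R)) (fun L L' =>
    [\/ ambient_isotopic L L', four_move L L' | four_move L' L]).

(* Closed braids on n strands, drawn in the plane z = 0 except near crossings.
   Strand positions k = 0, ..., n.-1 are the lines x = 2k. The j-th letter
   (i, s) of the braid word occupies the strip 2j <= y <= 2j + 2, where the
   strands in positions i and i.+1 cross; the strand going from i to i.+1 is
   the upper one if s is true and the lower one if s is false. *)
Definition braid_letter (R : realType) (n j : nat) (l : nat * bool) :
    set (R3 R) :=
  let h : int := if l.2 then 1 else -1 in
  let x : int := (2 * l.1)%N in
  let y : int := (2 * j)%N in
  polyline [:: pt R x y 0; pt R (x + 1) (y + 1) h; pt R (x + 2) (y + 2) 0] `|`
  polyline [:: pt R (x + 2) y 0; pt R (x + 1) (y + 1) (- h);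
               pt R x (y + 2) 0] `|`
  \bigcup_(k in [set k | [/\ (k < n)%N, k <> l.1 & k <> l.1.+1]])
    segment (pt R (2 * k)%N y 0) (pt R (2 * k)%N (y + 2) 0).
Arguments braid_letter : clear implicits.

(* The arc that joins the top (2k, 2N, 0) of strand position k to its bottom
   (2k, 0, 0), running to the right of the braid; these arcs are nested. *)
Definition closing_arc (R : realType) (n N k : nat) : set (R3 R) :=
  let x : int := (2 * k)%N in
  let x' : int := (2 * (2 * n - k))%N in
  let y : int := (2 * N)%N in
  let d : int := (2 * (n - k))%N in
  polyline [:: pt R x y 0; pt R x (y + d) 0; pt R x' (y + d) 0;
               pt R x' (- d) 0; pt R x (- d) 0; pt R x 0 0].
Arguments closing_arc : clear implicits.

Definition closed_braid (R : realType) (n : nat) (w : seq (nat * bool)) :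
    set (S3 R) :=
  Some @` (\bigcup_(j in [set j | (j < size w)%N])
             braid_letter R n j (nth (0%N, true) w j) `|`
           \bigcup_(k in [set k | (k < n)%N]) closing_arc R n (size w) k).
Arguments closed_braid : clear implicits.

(* The closure of the alternating 4-braid (s_1 s_2^-1 s_3)^3 is a drawing of
   the basic polyhedron 9*: its nine crossings are the vertices of a 4-valent
   planar graph without bigons, with eight triangles and three quadrilaterals.
   nine_star_word a substitutes for the vertex number k (from 1) the integer
   tangle given by the k-th entry of a, as that many crossings in a row along
   the braid, such that the diagram is alternating.

   The vertices 2, 5, 8 are the letters s_2^-1; they form one of the two orbits
   of vertices under the symmetries of 9*, the remaining six vertices forming
   the other one. Orbit and direction of the twists agree with Conway's
   conventions: the knots 9*20 and 9*.20 (10_121 and 10_122, of determinants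
   115 and 105) arise by doubling across the braid direction s_1 and s_2^-1
   respectively, so that the tangle 2 doubles along the braid direction. *)
Definition nine_star_word (a : seq nat) : seq (nat * bool) :=
  flatten [seq nseq (nth 1%N a k) ((k %% 3)%N, (k %% 3 != 1)%N)
          | k <- iota 0 9].

(* 9*.2:.2:.2, that is, the closure of (s_1 s_2^-2 s_3)^3 *)
Definition link_12_2_Jab (R : realType) : set (S3 R) :=
  closed_braid R 4 (nine_star_word [:: 1; 2; 1; 1; 2; 1; 1; 2; 1]%N).
Arguments link_12_2_Jab : clear implicits.

Definition Hopf_link (R : realType) : set (S3 R) :=
  closed_braid R 2 [:: (0, true); (0, true)]%N.
Arguments Hopf_link : clear implicits.

(* Main.v *)
Require Import Defs.
From Stdlib Require Import ZArith.
From mathcomp Require Import ssrZ zify ring lra.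

Set Implicit Arguments.
Unset Strict Implicit.
Unset Printing Implicit Defensive.

Import Order.TTheory GRing.Theory Num.Theory.
Import numFieldNormedType.Exports.

Delimit Scope nat_scope with N.
Local Open Scope classical_set_scope.
Local Open Scope ring_scope.

(** Inserting or deleting a factor s_i^4 or s_i^-4 in a braid changes its closure
    by a 4-move, so conjugacy in the quotient of the braid group by the fourth
    powers of the generators implies that the closures are related by 4-moves.
    In this quotient for four strands, (s_1 s_2^-2 s_3)^3 is conjugate to
    s_1^-1 s_3^-1 s_2 s_1^2 s_3^2 s_2, whose closure is the torus link T(2,6),
    drawn with eight crossings.  A last 4-move takes T(2,6), the closure of
    s_1^6, to the closure of s_1^2, which is the Hopf link.

    The proof exhibits one explicit reduction, on polygonal links with vertices
    on a fine grid.  Such a link is the list of its edges, and the list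
    [reduction] contains steps of two kinds.

    A triangle step replaces an edge ab by the two edges ac and cb, or
    conversely, where the triangle abc meets the rest of the link at most in a
    and b.  It is an ambient isotopy ([delta_isotopic]): each point is pushed in
    the direction from the midpoint m of ab to c, by an amount that is 1 at m
    and 0 outside a thin octahedron around the triangle.  This amount is a
    minimum of affine functions, and as each of them decreases at a rate below 1
    in the direction of the push, the push is injective; its inverse is a push
    of the same kind ([shearK], [shear_rescaleK]), so that continuity and
    properness are immediate.

    A 4-move step replaces two antipodal straight strands in a parallelepiped by
    two helices ([four_ok_four_move]); the affine map onto the standard ball is
    the homeomorphism that the move asks for.

    Whether a step applies is a finite question about the signs of integers:
    an octahedron and a segment are separated by at most two of its faces
    ([separated]).  So the whole reduction, from the closed braid of the link to
    the closed braid of the Hopf link, is validated by computation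
    ([reduction_certifies]). *)

(** * Homeomorphisms and isotopies of the 3-sphere *)

(** A neighbourhood of infinity is the complement of a compact set C, and the
    complement of the compact set g(C) is mapped into it. *)
Lemma extension_continuous (R : realType) (f g : R3 R -> R3 R) :
  continuous f -> continuous g -> cancel f g ->
  continuous (omap f : S3 R -> S3 R).
Proof.
move=> cf cg fK [x|] U /=.
  move=> nU; exact: (cf x _ nU).
case=> C [cptC cloC] CU; exists (g @` C).
  split.
    by apply: continuous_compact => //; apply: continuous_subspaceT.
  apply: compact_closed; last first.
    by apply: continuous_compact => //; apply: continuous_subspaceT.
  exact: norm_hausdorff.
move=> z [[x /= nx <-]|-> /=]; last by apply: CU; right.
apply: CU; left; exists (f x) => // Cfx; apply: nx; exists (f x) => //.
Qed.

Lemma extension_homeomorphism (R : realType) (f g : R3 R -> R3 R) :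
  continuous f -> continuous g -> cancel f g -> cancel g f ->
  homeomorphism (omap f : S3 R -> S3 R).
Proof.
move=> cf cg fK gK; split; first exact: extension_continuous cf cg fK.
exists (omap g); split.
- exact: extension_continuous cg cf gK.
- by case=> //= x; rewrite fK.
- by case=> //= x; rewrite gK.
Qed.

(** The isotopy is run backwards: the point H (1, x) goes to H (1 - t, x). *)
Lemma ambient_isotopic_sym (R : realType) (L L' : set (S3 R)) :
  ambient_isotopic L L' -> ambient_isotopic L' L.
Proof.
case=> H [cH hH H0] <-.
have h1 : homeomorphism (fun x => H (1, x)).
  by apply: hH; rewrite in_itv /= ler01 lexx.
have [c1 [g [cg gK Kg]]] := h1.
exists (fun p => H (1 - p.1, g p.2)); last first.
  rewrite /= subrr predeqE => x; split => [[y [z Lz <-] <-]|Lx].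
    by rewrite gK H0.
  by exists (H (1, x)); [exists x|rewrite gK H0].
have in01 (t : R) : t \in `[0, 1] -> 1 - t \in `[0, 1].
  by rewrite !in_itv /= => /andP[? ?]; apply/andP; split; lra.
split.
- apply/subspace_continuousP => -[t x] [/= t01 _].
  have /subspace_continuousP/(_ (1 - t, g x)) := cH.
  move=> /(_ (conj (in01 _ t01) I)) cHt U /cHt /=.
  rewrite !nbhs_simpl /within /=.
  have cp : (fun p : R * S3 R => (1 - p.1, g p.2)) @ (t, x) --> (1 - t, g x).
    apply: (@cvg_pair _ _ _ _ (nbhs (1 - t)) (nbhs (g x))) => /=.
      apply: cvgB; [exact: cvg_cst|exact: cvg_fst].
    by apply: cvg_comp; [exact: cvg_snd|exact: cg].
  move=> /cp; rewrite !nbhs_simpl /=; apply: filterS => -[s y] /= UH [/= s01 _].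
  by apply: UH; split => //; apply: in01.
- move=> t /in01 /hH [ct [k [ck kK Kk]]]; split => /=.
    move=> x; apply: (@continuous_comp _ _ _ g (fun x => H (1 - t, x))); [exact: cg|exact: ct].
  exists (fun x => H (1, k x)); split.
  + by move=> x; apply: (@continuous_comp _ _ _ k (fun x => H (1, x))); [exact: ck|exact: c1].
  + by move=> x; rewrite kK Kg.
  + by move=> x; rewrite gK Kk.
- by move=> x /=; rewrite subr0 Kg.
Qed.

(** * Shears along a direction *)

Definition translate (R : realType) (k : R) (v x : R3 R) : R3 R :=
  (x.1.1 + k * v.1.1, x.1.2 + k * v.1.2, x.2 + k * v.2).

Definition inner (R : realType) (x y : R3 R) : R :=
  x.1.1 * y.1.1 + x.1.2 * y.1.2 + x.2 * y.2.

Definition affine (R : realType) (l : R3 R * R) (x : R3 R) : R :=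
  inner l.1 x + l.2.

(** The bound 1 makes the displacement of the shear below bounded on the whole
    space, which yields continuity at infinity. *)
Definition bump (R : realType) (s : seq (R3 R * R)) (x : R3 R) : R :=
  Num.max 0 (foldr (fun l m => Num.min (affine l x) m) 1 s).

Definition shear (R : realType) (s : seq (R3 R * R)) (v : R3 R) (t : R)
  (x : R3 R) : R3 R := translate (t * bump s x) v x.

Lemma bump_ge0 (R : realType) s (x : R3 R) : 0 <= bump s x.
Proof. by rewrite /bump le_max lexx. Qed.

Lemma bump_le1 (R : realType) s (x : R3 R) : bump s x <= 1.
Proof.
rewrite /bump ge_max ler01 /=; elim: s => //= l s IH.
by rewrite ge_min IH orbT.
Qed.

Lemma continuous_coordinates (R : realType) :
  [/\ continuous (fun x : R3 R => x.1.1), continuous (fun x : R3 R => x.1.2) &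
      continuous (fun x : R3 R => x.2)].
Proof.
by split=> x; [apply: (@cvg_comp _ _ _ fst fst); exact: cvg_fst
              |apply: (@cvg_comp _ _ _ fst snd); [exact: cvg_fst|exact: cvg_snd]
              |exact: cvg_snd].
Qed.

Lemma continuous_inner (R : realType) (n : R3 R) : continuous (inner n).
Proof.
have [c1 c2 c3] := continuous_coordinates R.
by move=> x; apply: cvgD; first apply: cvgD;
  (apply: cvgM; first exact: cvg_cst); [exact: c1|exact: c2|exact: c3].
Qed.

Lemma continuous_bump (R : realType) (s : seq (R3 R * R)) : continuous (bump s).
Proof.
move=> x; apply: (@continuous_max _ _ (fun=> 0)
  (fun x => foldr (fun l m => Num.min (affine l x) m) 1 s)); first exact: cvg_cst.
elim: s => [|l s IH] /=; first exact: cvg_cst.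
apply: (@continuous_min _ _ (affine l)
  (fun x => foldr (fun l m => Num.min (affine l x) m) 1 s)) => //.
by apply: cvgD; [exact: continuous_inner|exact: cvg_cst].
Qed.

Lemma continuous_shear (R : realType) s (v : R3 R) :
  continuous (fun p : R * R3 R => shear s v p.1 p.2).
Proof.
move=> [t x]; rewrite /shear /translate.
have cb : (fun p : R * R3 R => bump s p.2) @ (t, x) --> bump s x.
  by apply: cvg_comp; [exact: cvg_snd|exact: continuous_bump].
have ck : (fun p : R * R3 R => p.1 * bump s p.2) @ (t, x) --> t * bump s x.
  by apply: cvgM => //; exact: cvg_fst.
have c2 : (fun p : R * R3 R => p.2) @ (t, x) --> x by exact: cvg_snd.
have cs (i : R3 R -> R) (w : R) : continuous i ->
    (fun p : R * R3 R => i p.2 + p.1 * bump s p.2 * w) @ (t, x) --> i x + t * bump s x * w.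
  move=> ci; apply: cvgD; first exact: (cvg_comp _ _ c2 (ci x)).
  by apply: cvgM => //; exact: cvg_cst.
have [i1 i2 i3] := continuous_coordinates R.
apply: (@cvg_pair _ _ _ _ (nbhs (_, _)) (nbhs _)); last exact: (cs _ v.2 i3).
by apply: (@cvg_pair _ _ _ _ (nbhs _) (nbhs _)); [exact: (cs _ v.1.1 i1)|exact: (cs _ v.1.2 i2)].
Qed.

Lemma continuous_shear_at (R : realType) s (v : R3 R) (t : R) :
  continuous (shear s v t).
Proof.
move=> x; apply: (@continuous_comp _ _ _ (pair t) (fun p => shear s v p.1 p.2)).
  by apply: (@cvg_pair _ _ _ _ (nbhs t) (nbhs x)); [exact: cvg_cst|exact: cvg_id].
exact: continuous_shear.
Qed.

(** The affine function l seen after a shear: at a point where l and the bump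
    agree, the shear increases l by the factor 1 + t * inner l.1 v. *)
Definition rescale (R : realType) (v : R3 R) (t : R) (l : R3 R * R) : R3 R * R :=
  let c := (1 + t * inner l.1 v)^-1 in
  ((c * l.1.1.1, c * l.1.1.2, c * l.1.2), c * l.2).

(** For each l, the difference between l and the value b of the bump at x keeps
    its sign when l is rescaled and x is sheared. So the minimum of the rescaled
    functions, truncated to [0, 1], is still b. *)
Lemma bump_rescale (R : realType) s (v : R3 R) (t : R) (x : R3 R) :
  (forall l, l \in s -> 0 < 1 + t * inner l.1 v) ->
  bump (map (rescale v t) s) (shear s v t x) = bump s x.
Proof.
move=> slope; rewrite /shear; set b := bump s x; set y := translate _ _ _.
set m := foldr (fun l m => Num.min (affine l x) m) 1.
set m' := foldr (fun l m => Num.min (affine l y) m) 1.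
have b1 : b <= 1 := bump_le1 s x.
have H r : {subset r <= s} -> (b <= m' (map (rescale v t) r)) = (b <= m r) /\
    (m' (map (rescale v t) r) <= b) = (m r <= b).
  elim: r => [|l r IH] sub; first by [].
  have [|IH1 IH2] := IH; first by move=> k kr; apply: sub; rewrite inE kr orbT.
  rewrite map_cons [m' (_ :: _)]/= [m (_ :: _)]/= -/m' -/m.
  have /slope cl : l \in s by apply: sub; rewrite inE eqxx.
  have -> : affine (rescale v t l) y =
      b + (1 + t * inner l.1 v)^-1 * (affine l x - b).
    rewrite /affine /rescale /y /translate /inner /=; field.
    by rewrite -/(inner l.1 v) gt_eqF.
  have ci : 0 < (1 + t * inner l.1 v)^-1 by rewrite invr_gt0.
  rewrite !le_min !ge_min IH1 IH2 lerDl gerDl pmulr_rge0 // pmulr_rle0 //.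
  by rewrite subr_ge0 subr_le0.
have [//|H1 H2] := H s.
change (Num.max 0 (m' (map (rescale v t) s)) = b).
have : b = Num.max 0 (m s) by [].
case: (leP (m s) 0) => ms0 eb.
  by rewrite eb; apply/max_idPl; move: H2; rewrite eb => ->.
have e : m' (map (rescale v t) s) = b.
  by apply/eqP; rewrite eq_le H1 H2 eb lexx.
by rewrite e; apply/max_idPr; rewrite eb ltW.
Qed.

Lemma rescaleK (R : realType) (v : R3 R) (t : R) (l : R3 R * R) :
  0 < 1 + t * inner l.1 v ->
  [/\ inner (rescale v t l).1 v = inner l.1 v / (1 + t * inner l.1 v) &
      rescale v (- t) (rescale v t l) = l].
Proof.
move=> cl; have E : inner (rescale v t l).1 v = inner l.1 v / (1 + t * inner l.1 v).
  by rewrite /rescale /inner /=; ring.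
split=> //; rewrite {1}/rescale E.
have -> : (1 + - t * (inner l.1 v / (1 + t * inner l.1 v)))^-1 = 1 + t * inner l.1 v.
  have c0 : 1 + t * inner l.1 v != 0 by rewrite gt_eqF.
  rewrite -[RHS]invrK; congr (_ ^-1); field => //.
have c0 : 1 + t * inner l.1 v != 0 by rewrite gt_eqF.
rewrite /rescale /= !mulrA !divff // !mul1r.
by case: l {cl E c0} => [[[]]].
Qed.

Lemma shearK (R : realType) s (v : R3 R) (t : R) :
  (forall l, l \in s -> 0 < 1 + t * inner l.1 v) ->
  cancel (shear s v t) (shear (map (rescale v t) s) v (- t)).
Proof.
move=> slope x; rewrite {1}/shear bump_rescale //.
by rewrite /shear /translate /= !mulNr !addrK; case: x => [[]].
Qed.

(** Rescaling twice, for t and for - t, gives the functions back, so this is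
    [shearK] for the rescaled functions. *)
Lemma shear_rescaleK (R : realType) s (v : R3 R) (t : R) :
  (forall l, l \in s -> 0 < 1 + t * inner l.1 v) ->
  cancel (shear (map (rescale v t) s) v (- t)) (shear s v t).
Proof.
move=> slope; have -> : shear s v t =
    shear (map (rescale v (- t)) (map (rescale v t) s)) v (- - t).
  rewrite opprK -map_comp; congr (shear _ _ _).
  by rewrite -[LHS]map_id; apply/eq_in_map => l /slope /rescaleK[].
apply: shearK => _ /mapP[l /slope cl ->].
have [-> _] := rescaleK cl.
rewrite [X in 0 < X](_ : _ = (1 + t * inner l.1 v)^-1) ?invr_gt0 //.
by field; rewrite gt_eqF.
Qed.

(** At infinity: the displacement is at most (|t| + 1) |v| for times near t, so
    points outside a large enough box stay outside a given compact set. *)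
Lemma extended_shear_continuous (R : realType) s (v : R3 R) :
  continuous (fun p : R * S3 R => omap (shear s v p.1) p.2 : S3 R).
Proof.
move=> [t [x|]] U /=.
  move=> nU; have [[A B] /= [nA nB] AB] : nbhs (t, x)
    ((fun p => shear s v p.1 p.2) @^-1` (Some @^-1` U)) := @continuous_shear _ s v (t, x) _ nU.
  exists (A, Some @` B) => /=.
    by split=> //; exact: one_point_compactification_some_nbhs.
  by case=> t' _ [/= At [y By <-]]; apply: (AB (t', y)).
case=> C [cptC cloC] CU.
have [M [_ CM]] := compact_bounded cptC.
(* M + 1 bounds C, the rest bounds the displacement. *)
pose r := M + 1 + (`|t| + 1) * (`|v.1.1| + `|v.1.2| + `|v.2|).
pose D : set (R3 R) := (`[- r, r] `*` `[- r, r]) `*` `[- r, r].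
have cI : compact (`[- r, r] : set R) by exact: segment_compact.
have cD : compact D := compact_setX (compact_setX cI cI) cI.
exists (ball t 1, (Some @` (~` D)) `|` [set None]) => /=.
  split; first exact: nbhsx_ballx.
  exists D => //; split=> //; apply: compact_closed => //; exact: norm_hausdorff.
case=> t' _ [/= tt' [[x nDx <-]|->]] /=; apply: CU; last by right.
left; exists (shear s v t' x) => // Cx; apply: nDx.
have := CM (M + 1); rewrite ltrDl ltr01 => /(_ isT _ Cx) /=.
rewrite /shear /translate; set k := t' * _.
have kt : `|k| <= `|t| + 1.
  rewrite normrM (ger0_norm (bump_ge0 s x)).
  apply: (@le_trans _ _ `|t'|); first by rewrite ler_piMr // bump_le1.
  move: tt'; rewrite /ball /= => tt'.
  by rewrite -[t'](subrK t) (le_trans (ler_normD _ _)) // addrC lerD2l distrC ltW.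
rewrite !prod_normE /= !ge_max => /andP[/andP[h1 h2] h3].
have B a b w : `|a + k * b| <= M + 1 -> `|b| <= w -> `|a| <= M + 1 + (`|t| + 1) * w.
  move=> h hb; rewrite -[a](addrK (k * b)) (le_trans (ler_normB _ _)) // lerD //.
  by rewrite normrM ler_pM.
have n1 := normr_ge0 v.1.1; have n2 := normr_ge0 v.1.2; have n3 := normr_ge0 v.2.
by split; [split|]; rewrite /= in_itv /= -ler_norml;
  [apply: (B _ _ _ h1)|apply: (B _ _ _ h2)|apply: (B _ _ _ h3)]; lra.
Qed.

(** On a line of direction v the shear is the identity plus t times a function
    whose slope exceeds -1, hence it is increasing. *)
Lemma shear_isotopic (R : realType) s (v : R3 R) (L : set (R3 R)) :
  (forall l, l \in s -> -1 < inner l.1 v) ->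
  ambient_isotopic (Some @` L : set (S3 R)) (Some @` (shear s v 1 @` L)).
Proof.
move=> slope; exists (fun p => omap (shear s v p.1) p.2); last first.
  rewrite predeqE => z; split.
    by case=> _ [x Lx <-] <-; exists (shear s v 1 x) => //; exists x.
  by case=> _ [x Lx <-] <-; exists (Some x) => //; exists x.
split.
- by apply: continuous_subspaceT; exact: extended_shear_continuous.
- move=> t; rewrite in_itv /= => /andP[t0 t1].
  have st l : l \in s -> 0 < 1 + t * inner l.1 v.
    by move=> /slope; case: (lerP 0 (inner l.1 v)) => ? ?; nra.
  apply: (extension_homeomorphism (g := shear (map (rescale v t) s) v (- t))).
  + exact: continuous_shear_at.
  + exact: continuous_shear_at.
  + exact: shearK.
  + exact: shear_rescaleK.
- by case=> //= x; rewrite /shear /translate !mul0r !addr0; case: x => [[]].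
Qed.

(** * Triangle steps on polygons *)

Definition combine (R : realType) (t : R) (a b : R3 R) : R3 R :=
  ((1 - t) * a.1.1 + t * b.1.1, (1 - t) * a.1.2 + t * b.1.2,
   (1 - t) * a.2 + t * b.2).

Lemma segmentP (R : realType) (a b x : R3 R) :
  segment a b x <-> exists2 t : R, 0 <= t <= 1 & x = combine t a b.
Proof.
split=> [[t /=]|[t t01 ->]]; first by rewrite in_itv /= => t01 <-; exists t.
by exists t => //=; rewrite in_itv.
Qed.

(** Twice the vector from the midpoint of a and b to x; the factor 2 keeps grid
    points integral. *)
Definition from_midpoint (R : realType) (a b x : R3 R) : R3 R :=
  (2 * x.1.1 - a.1.1 - b.1.1, 2 * x.1.2 - a.1.2 - b.1.2, 2 * x.2 - a.2 - b.2).

(** Let m be the midpoint of ab. The faces of the octahedron are given by the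
    vectors g: the affine function 1 + inner g (from_midpoint a b x) is 1 at m
    and vanishes on one face. The first three conditions say that a and b lie on
    the boundary and that each face contains one of them in its plane; hence the
    bump is piecewise linear on ab, with value 1 at m and 0 at a and b, and the
    shear maps ab onto the broken line acb. The fourth condition is the slope
    condition of [shear_isotopic] for the direction v from m to c, and the last
    one says that L avoids the interior of the octahedron. *)
Lemma delta_isotopic (R : realType) (G : seq (R3 R)) (a b c : R3 R)
    (L : set (R3 R)) :
  (forall g, g \in G -> inner g (from_midpoint a b b) = 1 \/
                        inner g (from_midpoint a b b) = -1) ->
  (exists2 g, g \in G & inner g (from_midpoint a b b) = 1) ->
  (exists2 g, g \in G & inner g (from_midpoint a b b) = -1) ->
  (forall g, g \in G -> -1 < inner g (from_midpoint a b c)) ->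
  (forall x, L x -> exists2 g, g \in G & 1 + inner g (from_midpoint a b x) <= 0) ->
  ambient_isotopic (Some @` (segment a b `|` L) : set (S3 R))
                   (Some @` (segment a c `|` segment c b `|` L)).
Proof.
move=> eG [g1 g1G e1] [g2 g2G e2] slope out.
pose ell (g : R3 R) : R3 R * R :=
  ((2 * g.1.1, 2 * g.1.2, 2 * g.2), 1 + inner g (from_midpoint a b (0, 0, 0))).
pose s := map ell G.
pose v : R3 R := (2^-1 * (from_midpoint a b c).1.1, 2^-1 * (from_midpoint a b c).1.2,
                  2^-1 * (from_midpoint a b c).2).
have ellE g x : affine (ell g) x = 1 + inner g (from_midpoint a b x).
  by rewrite /affine /ell /inner /from_midpoint /=; ring.
have bump0 x : L x -> bump s x = 0.
  move=> /out[g gG gx]; apply/eqP; rewrite eq_le bump_ge0 andbT /bump ge_max lexx /=.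
  rewrite /s; elim: (G) gG {eG g1G g2G slope out s} => // h r IH.
  by rewrite inE /= ge_min => /orP[/eqP <-|/IH ->]; rewrite ?orbT // ellE gx.
have bumpab t : 0 <= t <= 1 ->
    bump s (combine t a b) = Num.min (2 * t) (2 * (1 - t)).
  move=> /andP[t0 t1].
  have val g : inner g (from_midpoint a b (combine t a b)) =
      (2 * t - 1) * inner g (from_midpoint a b b).
    by rewrite /inner /from_midpoint /combine /=; ring.
  set m := Num.min _ _.
  have m01 : 0 <= m <= 1.
    by rewrite /m; case: (leP (2 * t) (2 * (1 - t))) => ?; apply/andP; split; lra.
  have lower : m <= foldr (fun l k => Num.min (affine l (combine t a b)) k) 1 s.
    rewrite /s; elim: (G) eG {g1G g2G slope out s bump0} => [|g r IH] eG /=.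
      by case/andP: m01.
    rewrite le_min IH ?andbT => [|h hr]; last by apply: eG; rewrite inE hr orbT.
    rewrite ellE val /m ge_min.
    have [->|->] := eG g (mem_head _ _); apply/orP; [left|right]; lra.
  have upper g : g \in G ->
      foldr (fun l k => Num.min (affine l (combine t a b)) k) 1 s <=
        affine (ell g) (combine t a b).
    rewrite /s; elim: (G) {eG g1G g2G slope out s bump0 lower} => // h r IH.
    by rewrite inE /= ge_min => /orP[/eqP <-|/IH ->]; rewrite ?lexx ?orbT.
  rewrite /bump; apply/eqP; rewrite eq_le; apply/andP; split.
    rewrite ge_max; apply/andP; split; first by case/andP: m01.
    rewrite le_min; apply/andP; split.
      by apply: le_trans (upper _ g1G) _; rewrite ellE val e1; lra.
    by apply: le_trans (upper _ g2G) _; rewrite ellE val e2; lra.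
  by rewrite le_max lower orbT.
have -> : segment a c `|` segment c b `|` L = shear s v 1 @` (segment a b `|` L).
  have shearL x : L x -> shear s v 1 x = x.
    move=> /bump0; rewrite /shear /translate => ->.
    by rewrite mulr0 !mul0r !addr0; case: x => [[]].
  have shear1 t : 0 <= t <= 1 ->
      shear s v 1 (combine (t / 2) a b) = combine t a c.
    move=> /andP[t0 t1]; rewrite /shear bumpab; last by apply/andP; split; lra.
    rewrite min_l; last by lra.
    by rewrite /translate /combine /v /from_midpoint /=; congr (_, _, _); field.
  have shear2 t : 0 <= t <= 1 ->
      shear s v 1 (combine ((1 + t) / 2) a b) = combine t c b.
    move=> /andP[t0 t1]; rewrite /shear bumpab; last by apply/andP; split; lra.
    rewrite min_r; last by lra.
    by rewrite /translate /combine /v /from_midpoint /=; congr (_, _, _); field.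
  rewrite predeqE => x; split.
    case=> [[/segmentP[t t01 ->]|/segmentP[t t01 ->]]|Lx].
    - exists (combine (t / 2) a b); last exact: shear1.
      by left; apply/segmentP; exists (t / 2) => //; case/andP: t01 => ? ?; apply/andP; split; lra.
    - exists (combine ((1 + t) / 2) a b); last exact: shear2.
      by left; apply/segmentP; exists ((1 + t) / 2) => //; case/andP: t01 => ? ?; apply/andP; split; lra.
    - by exists x; [right|exact: shearL].
  case=> y [/segmentP[t /andP[t0 t1] ->]|Ly] <-; last by right; rewrite shearL.
  left; case: (lerP t 2^-1) => ht.
    left; apply/segmentP; exists (2 * t); first by apply/andP; split; lra.
    rewrite -shear1; last by apply/andP; split; lra.
    by congr (shear _ _ _ (combine _ _ _)); field.
  right; apply/segmentP; exists (2 * t - 1); first by apply/andP; split; lra.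
  rewrite -shear2; last by apply/andP; split; lra.
  by congr (shear _ _ _ (combine _ _ _)); field.
apply: shear_isotopic => _ /mapP[g gG ->] /=.
rewrite [inner _ _](_ : _ = inner g (from_midpoint a b c)) ?slope //.
by rewrite /inner /v /=; field.
Qed.

(** * Polygonal links with integral vertices *)

Notation zpoint := (Z * Z * Z)%type.
Notation soup := (seq (zpoint * zpoint)).

Definition zsub (a b : zpoint) : zpoint :=
  (a.1.1 - b.1.1, a.1.2 - b.1.2, a.2 - b.2)%Z.
Definition zadd (a b : zpoint) : zpoint :=
  (a.1.1 + b.1.1, a.1.2 + b.1.2, a.2 + b.2)%Z.
Definition zscale (k : Z) (a : zpoint) : zpoint :=
  (k * a.1.1, k * a.1.2, k * a.2)%Z.
Definition zdot (a b : zpoint) : Z :=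
  (a.1.1 * b.1.1 + a.1.2 * b.1.2 + a.2 * b.2)%Z.
Definition zcross (a b : zpoint) : zpoint :=
  (a.1.2 * b.2 - a.2 * b.1.2, a.2 * b.1.1 - a.1.1 * b.2,
   a.1.1 * b.1.2 - a.1.2 * b.1.1)%Z.
Definition zmid (a b x : zpoint) : zpoint := zsub (zsub (zadd x x) a) b.

(** The number of grid steps in the unit length. *)
Definition grid : Z := 40.

Definition real_of (R : realType) (z : Z) : R := (int_of_Z z)%:~R.

Definition embed (R : realType) (p : zpoint) : R3 R :=
  (real_of R p.1.1 / real_of R grid, real_of R p.1.2 / real_of R grid,
   real_of R p.2 / real_of R grid).

Definition soup_set (R : realType) (s : soup) : set (R3 R) :=
  [set x | exists2 e, e \in s & segment (embed R e.1) (embed R e.2) x].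
Arguments soup_set : clear implicits.

(** The faces of a thin octahedron around the triangle abc, as vectors g of
    [delta_isotopic] multiplied by the first component, in grid units. With m the
    midpoint of ab and n a normal vector, the vertices of its section by the plane
    of the triangle are a, b, a point slightly beyond c on the ray from m through
    c, and a point slightly behind m. The two remaining vertices lie on the normal
    through m, at a distance below 1/8 of a grid step. *)
Definition octahedron (a b c : zpoint) : Z * seq zpoint :=
  let k := 1024%Z in
  let e := zsub b a in let w := zmid a b c in
  let n := zcross e w in
  let u := zscale k (zcross w n) in
  let g := zcross n e in
  let h := zscale (8 * k * (Z.abs n.1.1 + Z.abs n.1.2 + Z.abs n.2))%Z n in
  let g1 := zscale (k - 1)%Z g in let g2 := zscale (- (k * k))%Z g in
  let u' := zscale (-1)%Z u in
  ((k * zdot n n)%Z,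
   [:: zsub (zsub u g1) h; zadd (zsub u g1) h; zsub (zsub u g2) h; zadd (zsub u g2) h;
       zsub (zsub u' g1) h; zadd (zsub u' g1) h; zsub (zsub u' g2) h; zadd (zsub u' g2) h]).

(** Unlike [has], this stops at the first success under call by value. *)
Fixpoint lazy_has (T : Type) (a : pred T) (s : seq T) : bool :=
  if s is x :: s' then if a x then true else lazy_has a s' else false.

(** A sufficient condition for no point of e to be interior to all half-spaces of
    gs. Either both ends of e are on the outer side of one face plane, or two of
    the conditions, f > 0 and g > 0, hold on a final and on an initial part of e
    and exclude each other, which means f(q) g(p) <= f(p) g(q) for the ends p and
    q of e. *)
Definition separated (m : Z) (gs : seq zpoint) (a b : zpoint)
    (e : zpoint * zpoint) : bool :=
  let p := zmid a b e.1 in let q := zmid a b e.2 in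
  if lazy_has (fun g => if (m + zdot g p <=? 0)%Z then (m + zdot g q <=? 0)%Z
                        else false) gs then true else
  let z := [seq ((m + zdot g p)%Z, (m + zdot g q)%Z) | g <- gs] in
  lazy_has (fun u => if (u.1 <=? 0)%Z then
    lazy_has (fun v => if (v.2 <=? 0)%Z then (u.2 * v.1 <=? u.1 * v.2)%Z else false) z
    else false) z.

(** The conditions of [delta_isotopic] are tested on the faces themselves, which
    makes the soundness of a step independent of the choice of the octahedron. *)
Definition delta_free (a b c : zpoint) (s : soup) : bool :=
  let: (m, gs) := octahedron a b c in
  let e := zsub b a in let w := zmid a b c in
  [&& (0 <? m)%Z, all (fun g => (zdot g e =? m)%Z || (zdot g e =? - m)%Z) gs,
      has (fun g => (zdot g e =? m)%Z) gs, has (fun g => (zdot g e =? - m)%Z) gs,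
      all (fun g => (- m <? zdot g w)%Z) gs & all (separated m gs a b) s].

(** c - a = (l / m) (b - a) with 0 <= l / m <= 1. *)
Definition on_edge (a b c : zpoint) : bool :=
  let e := zsub b a in let f := zsub c a in
  let l := zdot f e in let m := zdot e e in
  [&& (0 <? m)%Z, (0 <=? l)%Z, (l <=? m)%Z & zscale m f == zscale l e].

Lemma real_ofD (R : realType) x y : real_of R (x + y)%Z = real_of R x + real_of R y.
Proof. by rewrite /real_of (raddfD int_of_Z) intrD. Qed.

Lemma real_ofN (R : realType) x : real_of R (- x)%Z = - real_of R x.
Proof. by rewrite /real_of (raddfN int_of_Z) rmorphN. Qed.

Lemma real_ofB (R : realType) x y : real_of R (x - y)%Z = real_of R x - real_of R y.
Proof. by rewrite /Z.sub real_ofD real_ofN. Qed.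

Lemma real_ofM (R : realType) x y : real_of R (x * y)%Z = real_of R x * real_of R y.
Proof. by rewrite /real_of (rmorphM int_of_Z) intrM. Qed.

Lemma real_of0 (R : realType) : real_of R 0%Z = 0.
Proof. by []. Qed.

Lemma real_of_le (R : realType) x y : (x <= y)%Z -> real_of R x <= real_of R y.
Proof. by move=> xy; rewrite /real_of ler_int; lia. Qed.

Lemma real_of_lt (R : realType) x y : (x < y)%Z -> real_of R x < real_of R y.
Proof. by move=> xy; rewrite /real_of ltr_int; lia. Qed.

Lemma real_of_grid (R : realType) : real_of R grid = 40.
Proof. by []. Qed.

Lemma real_of_int (R : realType) (z : int) : real_of R (Z_of_int z) = z%:~R.
Proof. by rewrite /real_of Z_of_intK. Qed.

Definition real_ofE := (real_ofD, real_ofN, real_ofB, real_ofM, real_of0).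

Lemma lazy_hasE (T : Type) (a : pred T) s : lazy_has a s = has a s.
Proof. by elim: s => //= x s ->; case: (a x). Qed.

Lemma inner_embed (R : realType) (g p : zpoint) (c : R) :
  inner (c * real_of R g.1.1, c * real_of R g.1.2, c * real_of R g.2) (embed R p) =
  c / real_of R grid * real_of R (zdot g p).
Proof. by rewrite /inner /embed /zdot /= !real_ofE; ring. Qed.

Lemma from_midpoint_embed (R : realType) (a b x : zpoint) :
  from_midpoint (embed R a) (embed R b) (embed R x) = embed R (zmid a b x).
Proof.
rewrite /from_midpoint /embed /zmid /zsub /zadd /= !real_ofE.
by congr (_, _, _); ring.
Qed.

Lemma nonpos_on_segment (R : realType) (t u1 u2 v1 v2 : R) :
  0 <= t <= 1 -> u1 <= 0 -> v2 <= 0 -> u2 * v1 <= u1 * v2 ->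
  (1 - t) * u1 + t * u2 <= 0 \/ (1 - t) * v1 + t * v2 <= 0.
Proof.
move=> /andP[t0 t1] le1 le2 le12.
have [|gu] := lerP ((1 - t) * u1 + t * u2) 0; first by left.
right; rewrite leNgt; apply/negP => gv.
have A : 0 <= (1 - t) * - u1 by rewrite mulr_ge0 // ?oppr_ge0 // subr_ge0.
have B : 0 <= t * - v2 by rewrite mulr_ge0 // oppr_ge0.
have C : (1 - t) * - u1 < t * u2 by rewrite mulrN -subr_gt0 opprK addrC.
have D : t * - v2 < (1 - t) * v1 by rewrite mulrN -subr_gt0 opprK.
have E : ((1 - t) * - u1) * (t * - v2) < (t * u2) * ((1 - t) * v1) by exact: ltr_pM.
have F : 0 <= t * (1 - t) by rewrite mulr_ge0 // subr_ge0.
have : t * (1 - t) * (u2 * v1) <= t * (1 - t) * (u1 * v2) by rewrite ler_wpM2l.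
move: E; rewrite !mulrN mulNr opprK.
have -> : (1 - t) * u1 * (t * v2) = t * (1 - t) * (u1 * v2) by ring.
have -> : t * u2 * ((1 - t) * v1) = t * (1 - t) * (u2 * v1) by ring.
by move=> /lt_le_trans h /h; rewrite ltxx.
Qed.

Lemma separated_segment (R : realType) (m : Z) gs a b e (x : R3 R) :
  (0 < m)%Z -> separated m gs a b e ->
  segment (embed R e.1) (embed R e.2) x ->
  exists2 g, g \in gs & 1 + inner (real_of R grid / real_of R m * real_of R g.1.1,
    real_of R grid / real_of R m * real_of R g.1.2,
    real_of R grid / real_of R m * real_of R g.2)
     (from_midpoint (embed R a) (embed R b) x) <= 0.
Proof.
move=> m0 sep /segmentP[t /andP[t0 t1] ->].
have rm0 : 0 < real_of R m by rewrite -(real_of0 R) real_of_lt.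
pose f g : R * R := (real_of R (m + zdot g (zmid a b e.1))%Z,
                     real_of R (m + zdot g (zmid a b e.2))%Z).
suff [g gs_g fg] : exists2 g, g \in gs & (1 - t) * (f g).1 + t * (f g).2 <= 0.
  exists g => //.
  set c := _ / _.
  have -> : from_midpoint (embed R a) (embed R b) (combine t (embed R e.1) (embed R e.2)) =
    combine t (from_midpoint (embed R a) (embed R b) (embed R e.1))
              (from_midpoint (embed R a) (embed R b) (embed R e.2)).
    by rewrite /from_midpoint /combine /=; congr (_, _, _); ring.
  rewrite !from_midpoint_embed.
  have -> n y z : inner n (combine t y z) = (1 - t) * inner n y + t * inner n z :> R.
    by rewrite /inner /combine /=; ring.
  rewrite !inner_embed /c -(pmulr_rle0 _ rm0); move: fg; rewrite /f /= !real_ofD.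
  have grid0 : real_of R grid != 0 by rewrite real_of_grid.
  have m_neq0 : real_of R m != 0 by rewrite gt_eqF.
  by congr (_ <= 0); field; rewrite ?m_neq0 ?grid0.
have [g1 [g2 [g1G g2G le1 le2 le12]]] : exists g1 g2, [/\ g1 \in gs, g2 \in gs,
    (m + zdot g1 (zmid a b e.1) <= 0)%Z, (m + zdot g2 (zmid a b e.2) <= 0)%Z &
    ((m + zdot g1 (zmid a b e.2)) * (m + zdot g2 (zmid a b e.1)) <=
     (m + zdot g1 (zmid a b e.1)) * (m + zdot g2 (zmid a b e.2)))%Z].
  move: sep; rewrite /separated !lazy_hasE.
  case: hasP => [[g gG]|_].
    case: Z.leb_spec => // le1 /Z.leb_le le2 _; exists g, g; split=> //; lia.
  case/hasP=> _ /mapP[g1 g1G ->] /=; case: Z.leb_spec => // le1; rewrite lazy_hasE.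
  case/hasP=> _ /mapP[g2 g2G ->] /=; case: Z.leb_spec => // le2 /Z.leb_le le12.
  by exists g1, g2.
have {}le1 : (f g1).1 <= 0 by rewrite -(real_of0 R) real_of_le.
have {}le2 : (f g2).2 <= 0 by rewrite -(real_of0 R) real_of_le.
have {}le12 : (f g1).2 * (f g2).1 <= (f g1).1 * (f g2).2.
  by rewrite /f /= -!real_ofM real_of_le.
have t01 : 0 <= t <= 1 by rewrite t0.
by have [?|?] := nonpos_on_segment t01 le1 le2 le12; [exists g1|exists g2].
Qed.

Lemma soup_set_mem (R : realType) (s s' : soup) :
  s =i s' -> soup_set R s = soup_set R s'.
Proof.
by move=> ss; rewrite predeqE => x; split=> -[e es ex]; exists e; rewrite ?ss // -ss.
Qed.

Lemma soup_set_cons (R : realType) e (s : soup) :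
  soup_set R (e :: s) = segment (embed R e.1) (embed R e.2) `|` soup_set R s.
Proof.
rewrite predeqE => x; split=> [[e' ]|[ex|[e' es ex]]].
- by rewrite inE => /orP[/eqP ->|es] ex; [left|right; exists e'].
- by exists e => //; rewrite inE eqxx.
- by exists e' => //; rewrite inE es orbT.
Qed.

Lemma delta_free_isotopic (R : realType) (a b c : zpoint) (s : soup) :
  delta_free a b c s ->
  ambient_isotopic (Some @` soup_set R ((a, b) :: s) : set (S3 R))
                   (Some @` soup_set R ((a, c) :: (c, b) :: s)).
Proof.
rewrite /delta_free; case: octahedron => m gs.
case/and5P => /Z.ltb_lt m0 /allP eG /hasP[g1 g1G /Z.eqb_eq e1] /hasP[g2 g2G /Z.eqb_eq e2].
case/andP => /allP slope /allP sep.
rewrite !soup_set_cons setUA /=.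
have rm0 : 0 < real_of R m by rewrite -(real_of0 R) real_of_lt.
have grid0 : real_of R grid != 0 by rewrite real_of_grid.
have m_neq0 : real_of R m != 0 by rewrite gt_eqF.
pose k := real_of R grid / real_of R m.
pose f (g : zpoint) : R3 R := (k * real_of R g.1.1, k * real_of R g.1.2, k * real_of R g.2).
have fE g x : inner (f g) (from_midpoint (embed R a) (embed R b) (embed R x)) =
    real_of R (zdot g (zmid a b x)) / real_of R m.
  by rewrite from_midpoint_embed inner_embed /k; field; apply/andP; split.
have ebE g : zdot g (zmid a b b) = zdot g (zsub b a).
  by rewrite /zdot /zmid /zsub /zadd /=; lia.
apply: (@delta_isotopic _ (map f gs)).
- move=> _ /mapP[g /eG eg ->]; rewrite fE ebE.
  case/orP: eg => /Z.eqb_eq ->; [left|right]; rewrite ?real_ofN ?mulNr divff //.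
- by exists (f g1); [exact: map_f|rewrite fE ebE e1 divff].
- by exists (f g2); [exact: map_f|rewrite fE ebE e2 real_ofN mulNr divff].
- move=> _ /mapP[g /slope /Z.ltb_lt gw ->]; rewrite fE.
  by rewrite ltr_pdivlMr // mulN1r -real_ofN real_of_lt.
- move=> x [e /sep es /(separated_segment m0 es)[g gG fg]].
  by exists (f g) => //; exact: map_f.
Qed.

Lemma on_edge_segment (R : realType) (a b c : zpoint) :
  on_edge a b c ->
  segment (embed R a) (embed R b) =
  segment (embed R a) (embed R c) `|` segment (embed R c) (embed R b).
Proof.
rewrite /on_edge; move: (zdot _ _) (zdot _ _) => l m.
case/and4P => /Z.ltb_lt m0 /Z.leb_le l0 /Z.leb_le lm /eqP E.
have rm0 : 0 < real_of R m by rewrite -(real_of0 R) real_of_lt.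
pose t := real_of R l / real_of R m.
have t0 : 0 <= t by apply: divr_ge0; [rewrite -(real_of0 R) real_of_le|exact: ltW].
have t1 : t <= 1 by rewrite ler_pdivrMr // mul1r real_of_le.
have grid0 : real_of R grid != 0 by rewrite real_of_grid.
have m_neq0 : real_of R m != 0 by rewrite gt_eqF.
have cE : embed R c = combine t (embed R a) (embed R b).
  have H x y z : (m * (z - x) = l * (y - x))%Z ->
      real_of R z / real_of R grid = (1 - t) * (real_of R x / real_of R grid) +
        t * (real_of R y / real_of R grid).
    move=> /(congr1 (real_of R)); rewrite !real_ofE => h.
    have -> : real_of R z = real_of R x + t * (real_of R y - real_of R x).
      rewrite -[LHS](subrK (real_of R x)) addrC; congr (_ + _).
      by apply: (mulfI m_neq0); rewrite h /t; field.
    by field.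
  move: E; rewrite /zscale /zsub /= => -[h1 h2 h3].
  by rewrite /embed /combine /=; congr (_, _, _); apply: H.
rewrite cE predeqE => x; split.
  case/segmentP => u /andP[u0 u1] ->; case: (lerP u t) => ut.
    left; apply/segmentP; case: (ltrP 0 t) => tp.
      exists (u / t); first by rewrite divr_ge0 //= ler_pdivrMr // mul1r.
      have tn0 : t != 0 by rewrite gt_eqF.
      have <- : u / t * t = u by rewrite divfK.
      by rewrite /combine mulfK //=; congr (_, _, _); ring.
    exists 0; first by rewrite lexx ler01.
    have -> : u = 0 by lra.
    have -> : t = 0 by lra.
    by rewrite /combine /=; congr (_, _, _); ring.
  have t1' : 0 < 1 - t by lra.
  have tn1 : 1 - t != 0 by rewrite gt_eqF.
  right; apply/segmentP; exists ((u - t) / (1 - t)).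
    by rewrite divr_ge0 ?ler_pdivrMr ?mul1r //=; lra.
  have -> : u = t + (u - t) / (1 - t) * (1 - t) by rewrite divfK // addrC subrK.
  rewrite [t + _ - t]addrC addKr mulfK //.
  by rewrite /combine /=; congr (_, _, _); ring.
case=> /segmentP[u /andP[u0 u1] ->]; apply/segmentP.
  exists (t * u); first by rewrite mulr_ge0 //=; nra.
  by rewrite /combine /=; congr (_, _, _); ring.
exists (t + u * (1 - t)); first by apply/andP; split; nra.
by rewrite /combine /=; congr (_, _, _); ring.
Qed.

(** * The ball of a 4-move *)

Definition rcross (R : realType) (x y : R3 R) : R3 R :=
  (x.1.2 * y.2 - x.2 * y.1.2, x.2 * y.1.1 - x.1.1 * y.2,
   x.1.1 * y.1.2 - x.1.2 * y.1.1).

Definition frame_map (R : realType) (o x y z u : R3 R) : R3 R :=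
  (o.1.1 + u.1.1 * x.1.1 + u.1.2 * y.1.1 + u.2 * z.1.1,
   o.1.2 + u.1.1 * x.1.2 + u.1.2 * y.1.2 + u.2 * z.1.2,
   o.2 + u.1.1 * x.2 + u.1.2 * y.2 + u.2 * z.2).

Definition frame_coord (R : realType) (o x y z p : R3 R) : R3 R :=
  let d := inner x (rcross y z) in
  let q := (p.1.1 - o.1.1, p.1.2 - o.1.2, p.2 - o.2) in
  (inner (rcross y z) q / d, inner (rcross z x) q / d, inner (rcross x y) q / d).

Lemma frame_mapK (R : realType) (o x y z : R3 R) :
  inner x (rcross y z) != 0 -> cancel (frame_map o x y z) (frame_coord o x y z).
Proof.
case: o x y z => [ [a1 a2] a3] [ [x1 x2] x3] [ [y1 y2] y3] [ [z1 z2] z3].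
rewrite /frame_map /frame_coord /inner /rcross /= => d [ [u1 u2] u3] /=.
by congr (_, _, _); field.
Qed.

Lemma frame_coordK (R : realType) (o x y z : R3 R) :
  inner x (rcross y z) != 0 -> cancel (frame_coord o x y z) (frame_map o x y z).
Proof.
case: o x y z => [ [a1 a2] a3] [ [x1 x2] x3] [ [y1 y2] y3] [ [z1 z2] z3].
rewrite /frame_map /frame_coord /inner /rcross /= => d [ [u1 u2] u3] /=.
by congr (_, _, _); field.
Qed.

Lemma continuous_triple (R : realType) (f1 f2 f3 : R3 R -> R) :
  continuous f1 -> continuous f2 -> continuous f3 ->
  continuous (fun p => (f1 p, f2 p, f3 p) : R3 R).
Proof.
move=> c1 c2 c3 x.
apply: (@cvg_pair _ _ _ _ (nbhs (_, _)) (nbhs _)); last exact: c3.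
by apply: (@cvg_pair _ _ _ _ (nbhs _) (nbhs _)); [exact: c1|exact: c2].
Qed.

Lemma continuous_affine (R : realType) (l : R3 R * R) : continuous (affine l).
Proof.
by move=> x; apply: cvgD; [exact: continuous_inner|exact: cvg_cst].
Qed.

Lemma continuous_frame_map (R : realType) (o x y z : R3 R) :
  continuous (frame_map o x y z).
Proof.
have -> : frame_map o x y z = fun p => (affine ((x.1.1, y.1.1, z.1.1), o.1.1) p,
    affine ((x.1.2, y.1.2, z.1.2), o.1.2) p, affine ((x.2, y.2, z.2), o.2) p).
  by apply/funext => p; rewrite /frame_map /affine /inner /=; congr (_, _, _); ring.
by apply: continuous_triple; exact: continuous_affine.
Qed.

Lemma continuous_frame_coord (R : realType) (o x y z : R3 R) :
  continuous (frame_coord o x y z).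
Proof.
pose d := inner x (rcross y z).
pose l (n : R3 R) := ((n.1.1 / d, n.1.2 / d, n.2 / d), - inner n o / d).
have -> : frame_coord o x y z = fun p => (affine (l (rcross y z)) p,
    affine (l (rcross z x)) p, affine (l (rcross x y)) p).
  apply/funext => p; rewrite /frame_coord -/d /l.
  move: (rcross y z) (rcross z x) (rcross x y) d^-1 => n1 n2 n3 d'.
  by rewrite /affine /inner /=; congr (_, _, _); ring.
by apply: continuous_triple; exact: continuous_affine.
Qed.

Lemma frame_map_combine (R : realType) (o x y z : R3 R) t a b :
  frame_map o x y z (combine t a b) =
  combine t (frame_map o x y z a) (frame_map o x y z b).
Proof. by rewrite /frame_map /combine /=; congr (_, _, _); ring. Qed.

Lemma frame_coord_combine (R : realType) (o x y z : R3 R) t a b :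
  frame_coord o x y z (combine t a b) =
  combine t (frame_coord o x y z a) (frame_coord o x y z b).
Proof.
rewrite /frame_coord; move: (rcross y z) (rcross z x) (rcross x y) => n1 n2 n3.
move: (inner x n1)^-1 => d.
by rewrite /combine /inner /=; congr (_, _, _); ring.
Qed.

Lemma frame_map_segment (R : realType) (o x y z a b : R3 R) :
  frame_map o x y z @` segment a b =
  segment (frame_map o x y z a) (frame_map o x y z b).
Proof.
rewrite predeqE => p; split.
  case=> _ /segmentP[t t01 ->] <-; apply/segmentP; exists t => //.
  exact: frame_map_combine.
case/segmentP=> t t01 ->; exists (combine t a b); last exact: frame_map_combine.
by apply/segmentP; exists t.
Qed.

Lemma frame_map_polyline (R : realType) (o x y z : R3 R) s :
  frame_map o x y z @` polyline s = polyline (map (frame_map o x y z) s).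
Proof.
elim: s => [|a [|b s] IH]; first by rewrite /= image_set0.
  by rewrite /= image_set1.
by rewrite [LHS]/= image_setU frame_map_segment IH.
Qed.

Lemma segment_left (R : realType) (a b : R3 R) : segment a b a.
Proof.
apply/segmentP; exists 0; first by rewrite lexx ler01.
by rewrite /combine !subr0 !mul1r !mul0r !addr0; case: a => [[]].
Qed.

Lemma segmentC (R : realType) (a b : R3 R) : segment a b = segment b a.
Proof.
suff H (u v : R3 R) : segment u v `<=` segment v u.
  by rewrite predeqE => x; split; apply: H.
move=> x /segmentP[t /andP[t0 t1] ->]; apply/segmentP; exists (1 - t).
  by apply/andP; split; lra.
by rewrite /combine; congr (_, _, _); ring.
Qed.

Lemma polyline_vertex (R : realType) (p : R3 R) s : p \in s -> polyline s p.
Proof.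
elim: s => [|a [|b s] IH] //; first by rewrite inE => /eqP ->.
rewrite inE => /orP[/eqP ->|ps]; first by left; exact: segment_left.
by right; exact: IH.
Qed.

Lemma polyline_sub_ball (R : realType) (s : seq (R3 R)) :
  (forall p, p \in s -> tangle_ball R p) -> polyline s `<=` tangle_ball R.
Proof.
elim: s => [|a [|b s] IH] H //; first by move=> x ->; apply: H; rewrite inE.
move=> x [/segmentP[t /andP[t0 t1] ->]|]; last first.
  by apply: IH => q ps; apply: H; rewrite inE ps orbT.
have [/andP[? ?] /andP[? ?] /andP[? ?]] := H a (mem_head _ _).
have /H[/andP[? ?] /andP[? ?] /andP[? ?]] : b \in [:: a, b & s] by rewrite !inE eqxx orbT.
by rewrite /tangle_ball /combine /=; split; apply/andP; split; nra.
Qed.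

Lemma twist_tangle_ball (R : realType) (c : int) :
  twist_tangle R c `<=` tangle_ball R.
Proof.
have H e : helix R c e `<=` tangle_ball R.
  apply: polyline_sub_ball => q /mapP[j]; rewrite mem_iota => /andP[_ j9] ->.
  have j0 : 0 <= (j%:Z)%:~R :> R by rewrite ler0z.
  have j8 : (j%:Z)%:~R <= 8 :> R by rewrite (ler_int R _ 8); lia.
  rewrite /pt /quarter; case: absz => [|[|[|?]]]; split => //=;
    rewrite ?j0 ?j8 //; apply/andP; split; lra.
by move=> x [/H|/H].
Qed.

(** c * 8 is a multiple of 4: the strands of all three tangles have the same
    ends. *)
Lemma twist_tangle_ends (R : realType) (c : int) : c = 0 \/ c = 1 \/ c = -1 ->
  [/\ twist_tangle R c (pt R 1 0 0), twist_tangle R c (pt R 1 0 8),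
      twist_tangle R c (pt R (-1) 0 0) & twist_tangle R c (pt R (-1) 0 8)].
Proof.
move=> c01; split.
- left; apply/polyline_vertex/mapP; exists 0%N => //.
  by case: c01 => [|[|]] ->.
- left; apply/polyline_vertex/mapP; exists 8%N => //.
  by case: c01 => [|[|]] ->.
- right; apply/polyline_vertex/mapP; exists 0%N => //.
  by case: c01 => [|[|]] ->.
- right; apply/polyline_vertex/mapP; exists 8%N => //.
  by case: c01 => [|[|]] ->.
Qed.

Definition edges (s : seq zpoint) : soup := zip s (behead s).
Definition flip_edge (e : zpoint * zpoint) := (e.2, e.1).

Definition place (o x y z u : zpoint) : zpoint :=
  zadd o (zadd (zscale u.1.1 x) (zadd (zscale u.1.2 y) (zscale u.2 z))).

Definition zhelix (c e : int) : seq zpoint :=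
  [seq (Z_of_int (quarter (c * j%:Z + e)).1, Z_of_int (quarter (c * j%:Z + e)).2,
        Z_of_int j%:Z) | j <- iota 0 9].

(** The flags r, r1 and r2 below tell whether a strand is traversed downwards,
    such that the edges of a link can be oriented coherently. *)
Definition strand_soup (r : bool) (o x y z : zpoint) (c e : int) : soup :=
  let s := edges (map (place o x y z) (zhelix c e)) in
  if r then map flip_edge s else s.

Definition twist_soup (r1 r2 : bool) (o x y z : zpoint) (c : int) : soup :=
  strand_soup r1 o x y z c 0 ++ strand_soup r2 o x y z c 2.

(** These numbers are at most 0 exactly if p lies in the parallelepiped; up to
    the factor d they are the values of [box_faces] at the coordinates of p. *)
Definition face_values (o x y z p : zpoint) : seq Z :=
  let q := zsub p o in
  let d := zdot x (zcross y z) in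
  let a := zdot (zcross y z) q in
  let b := zdot (zcross z x) q in
  let c := zdot (zcross x y) q in
  [:: a - 2 * d; - a - 2 * d; b - 2 * d; - b - 2 * d; - c; c - 8 * d]%Z.

(** The edge e lies beyond one face of the parallelepiped, except that one of its
    ends may be an end of a strand on that face. *)
Definition outside (o x y z : zpoint) (e : zpoint * zpoint) : bool :=
  let end_ p := p \in [:: place o x y z (1, 0, 0)%Z; place o x y z (1, 0, 8)%Z;
                         place o x y z (-1, 0, 0)%Z; place o x y z (-1, 0, 8)%Z] in
  has (fun v => [|| (0 <? v.1)%Z && (0 <? v.2)%Z,
                    [&& (0 <? v.1)%Z, (0 <=? v.2)%Z & end_ e.2] |
                    [&& (0 <=? v.1)%Z, (0 <? v.2)%Z & end_ e.1]])
      (zip (face_values o x y z e.1) (face_values o x y z e.2)).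

Definition four_ok (r1 r2 : bool) (o x y z : zpoint) (s : soup) : bool :=
  let t := twist_soup r1 r2 o x y z 0 in
  [&& (0 <? zdot x (zcross y z))%Z, all (mem s) t &
      all (outside o x y z) [seq e <- s | e \notin t]].

Definition box_faces (R : realType) (u : R3 R) : seq R :=
  [:: u.1.1 - 2; - u.1.1 - 2; u.1.2 - 2; - u.1.2 - 2; - u.2; u.2 - 8].

Lemma zip_map2 (A B A' B' : Type) (f : A -> A') (g : B -> B') s t :
  zip (map f s) (map g t) = [seq (f e.1, g e.2) | e <- zip s t].
Proof. by elim: s t => [|a s IH] [|b t] //=; rewrite IH. Qed.

#[local] Arguments Z.mul : simpl never.

Definition grid_map (R : realType) (o x y z : zpoint) : R3 R -> R3 R :=
  frame_map (embed R o) (embed R x) (embed R y) (embed R z).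

Definition grid_coord (R : realType) (o x y z : zpoint) : R3 R -> R3 R :=
  frame_coord (embed R o) (embed R x) (embed R y) (embed R z).

Lemma embed_det (R : realType) (x y z : zpoint) :
  inner (embed R x) (rcross (embed R y) (embed R z)) =
  real_of R (zdot x (zcross y z)) / real_of R grid ^+ 3.
Proof.
by rewrite -exprVn /inner /rcross /embed /zdot /zcross /= !real_ofE; ring.
Qed.

Lemma embed_det_neq0 (R : realType) (x y z : zpoint) :
  (0 < zdot x (zcross y z))%Z ->
  inner (embed R x) (rcross (embed R y) (embed R z)) != 0.
Proof.
move=> d0.
rewrite embed_det mulf_neq0 ?invr_eq0 ?expf_neq0 ?real_of_grid //.
by rewrite gt_eqF // -(real_of0 R) real_of_lt.
Qed.

Lemma place_embed (R : realType) (o x y z u : zpoint) :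
  grid_map o x y z (real_of R u.1.1, real_of R u.1.2, real_of R u.2) =
  embed R (place o x y z u).
Proof.
by rewrite /grid_map /frame_map /embed /place /zadd /zscale /= !real_ofE; congr (_, _, _); ring.
Qed.

Lemma face_values_embed (R : realType) (o x y z p : zpoint) :
  (0 < zdot x (zcross y z))%Z ->
  box_faces (grid_coord o x y z (embed R p)) =
  [seq real_of R v / real_of R (zdot x (zcross y z)) | v <- face_values o x y z p].
Proof.
move=> d0; set d := zdot x (zcross y z).
have rd0 : real_of R d != 0 by rewrite gt_eqF // -(real_of0 R) real_of_lt.
have g0 : real_of R grid != 0 by rewrite real_of_grid.
have dotE (n : zpoint) (a b : zpoint) :
    n = zcross a b ->
    inner (rcross (embed R a) (embed R b))
      ((embed R p).1.1 - (embed R o).1.1, (embed R p).1.2 - (embed R o).1.2,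
       (embed R p).2 - (embed R o).2) = real_of R (zdot n (zsub p o)) / real_of R grid ^+ 3.
  by move=> ->; rewrite -exprVn /inner /rcross /embed /zdot /zsub /zcross /= !real_ofE; ring.
have fcE : grid_coord o x y z (embed R p) = (real_of R (zdot (zcross y z) (zsub p o)) / real_of R d,
    real_of R (zdot (zcross z x) (zsub p o)) / real_of R d, real_of R (zdot (zcross x y) (zsub p o)) / real_of R d).
  have q3 k : k / real_of R grid ^+ 3 / (real_of R d / real_of R grid ^+ 3) = k / real_of R d.
    rewrite invf_div mulrA mulfVK // expf_neq0 //.
  by rewrite /grid_coord /frame_coord embed_det -/d !(dotE _ _ _ erefl) !q3.
have facesE (k a b c : R) : k != 0 -> box_faces (a / k, b / k, c / k) =
    [:: (a - 2 * k) / k; (- a - 2 * k) / k; (b - 2 * k) / k; (- b - 2 * k) / k;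
        - c / k; (c - 8 * k) / k].
  by move=> k0; rewrite /box_faces /=; congr [:: _; _; _; _; _; _]; field.
rewrite fcE facesE // /face_values [map _ _]/=.
by congr [:: _; _; _; _; _; _]; rewrite ?(real_ofB, real_ofN, real_ofM).
Qed.

Lemma box_faces_le0 (R : realType) (u : R3 R) (v : R) : tangle_ball R u -> v \in box_faces u -> v <= 0.
Proof.
case=> /andP[? ?] /andP[? ?] /andP[? ?]; rewrite !inE.
by do 5 (case/predU1P => [->|]; first by lra); move/eqP => ->; lra.
Qed.

Lemma box_faces_combine (R : realType) (t : R) (u v : R3 R) :
  box_faces (combine t u v) =
  [seq (1 - t) * w.1 + t * w.2 | w <- zip (box_faces u) (box_faces v)].
Proof. by rewrite /box_faces /combine /=; congr [:: _; _; _; _; _; _]; ring. Qed.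

(** Such an edge can meet the ball only at the ends of the strands. *)
Lemma outside_ball (R : realType) (o x y z : zpoint) e (p : R3 R) :
  (0 < zdot x (zcross y z))%Z -> outside o x y z e ->
  segment (embed R e.1) (embed R e.2) p -> tangle_ball R (grid_coord o x y z p) ->
  grid_coord o x y z p \in [:: pt R 1 0 0; pt R 1 0 8; pt R (-1) 0 0; pt R (-1) 0 8].
Proof.
move=> d0; set d := zdot x (zcross y z).
pose fc := grid_coord (R := R) o x y z.
have rd0 : 0 < real_of R d by rewrite -(real_of0 R) real_of_lt.
have endE q : q \in [:: place o x y z (1, 0, 0)%Z; place o x y z (1, 0, 8)%Z;
      place o x y z (-1, 0, 0)%Z; place o x y z (-1, 0, 8)%Z] ->
    fc (embed R q) \in [:: pt R 1 0 0; pt R 1 0 8; pt R (-1) 0 0; pt R (-1) 0 8].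
  rewrite !inE => /or4P[] /eqP ->; rewrite -place_embed /fc /grid_coord frame_mapK ?embed_det_neq0 //;
    apply/or4P; [constructor 1|constructor 2|constructor 3|constructor 4]; exact/eqP.
move=> /hasP[v vin out] /segmentP[t /andP[t0 t1] ->] ball.
have le0 : (1 - t) * (real_of R v.1 / real_of R d) + t * (real_of R v.2 / real_of R d) <= 0.
  apply: (box_faces_le0 ball).
  rewrite /grid_coord frame_coord_combine box_faces_combine -!/(grid_coord _ _ _ _ _).
  rewrite !face_values_embed // zip_map2 -map_comp.
  by apply/mapP; exists v.
have {}le0 : (1 - t) * real_of R v.1 + t * real_of R v.2 <= 0.
  by rewrite -(pmulr_lle0 _ (_ : 0 < (real_of R d)^-1)) ?invr_gt0 // mulrDl -!mulrA.
case/or3P: out => [/andP[/Z.ltb_lt v1 /Z.ltb_lt v2]|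
    /and3P[/Z.ltb_lt v1 /Z.leb_le v2 en]|/and3P[/Z.leb_le v1 /Z.ltb_lt v2 en]].
- have {}v1 : 0 < real_of R v.1 by rewrite -(real_of0 R) real_of_lt.
  have {}v2 : 0 < real_of R v.2 by rewrite -(real_of0 R) real_of_lt.
  by exfalso; nra.
- have {}v1 : 0 < real_of R v.1 by rewrite -(real_of0 R) real_of_lt.
  have {}v2 : 0 <= real_of R v.2 by rewrite -(real_of0 R) real_of_le.
  have -> : t = 1 by nra.
  by rewrite [combine _ _ _](_ : _ = embed R e.2) ?endE // /combine /=; congr (_, _, _); ring.
- have {}v1 : 0 <= real_of R v.1 by rewrite -(real_of0 R) real_of_le.
  have {}v2 : 0 < real_of R v.2 by rewrite -(real_of0 R) real_of_lt.
  have -> : t = 0 by nra.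
  by rewrite [combine _ _ _](_ : _ = embed R e.1) ?endE // /combine /=; congr (_, _, _); ring.
Qed.

Lemma soup_set_cat (R : realType) (s s' : soup) :
  soup_set R (s ++ s') = soup_set R s `|` soup_set R s'.
Proof.
rewrite predeqE => x; split=> [[e]|[|] [e es ex]].
- by rewrite mem_cat => /orP[es|es] ex; [left|right]; exists e.
- by exists e; rewrite ?mem_cat ?es.
- by exists e; rewrite ?mem_cat ?es ?orbT.
Qed.

Lemma soup_set_flip (R : realType) (s : soup) :
  soup_set R (map flip_edge s) = soup_set R s.
Proof.
rewrite predeqE => x; split=> [[_ /mapP[e es ->]] ex|[e es ex]].
  by exists e => //; rewrite segmentC.
by exists (flip_edge e); [exact: map_f|rewrite segmentC].
Qed.

Lemma soup_set_edges (R : realType) (s : seq zpoint) : (1 < size s)%N ->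
  soup_set R (edges s) = polyline (map (embed R) s).
Proof.
elim: s => [|a [|b [|c s]] IH] // _.
  rewrite /edges /= soup_set_cons; apply/seteqP; split=> x.
    by case=> [ab|[e]]; [left|].
  case=> [|->]; first by left.
  by left; rewrite segmentC; exact: segment_left.
by rewrite [edges _]/= soup_set_cons IH.
Qed.

Lemma strand_soup_set (R : realType) r o x y z c e :
  soup_set R (strand_soup r o x y z c e) =
  grid_map o x y z @` helix R c e.
Proof.
have -> : soup_set R (strand_soup r o x y z c e) =
    soup_set R (edges (map (place o x y z) (zhelix c e))).
  by rewrite /strand_soup; case: r => //; rewrite soup_set_flip.
rewrite soup_set_edges; last by rewrite !size_map size_iota.
rewrite /grid_map frame_map_polyline -!map_comp; congr polyline; apply/eq_map => j /=.
rewrite -place_embed /grid_map; congr (frame_map _ _ _ _ (_, _, _));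
  rewrite -(real_of_int R); reflexivity.
Qed.

Lemma twist_soup_set (R : realType) r1 r2 o x y z c :
  soup_set R (twist_soup r1 r2 o x y z c) =
  grid_map o x y z @` twist_tangle R c.
Proof. by rewrite soup_set_cat !strand_soup_set -image_setU. Qed.

(** The homeomorphism of the move takes the coordinates in the frame o, x, y, z.
    The edges that are kept meet the ball at most in the ends of the strands,
    which belong to the straight strands and to the helices alike. *)
Lemma four_ok_four_move (R : realType) (c : int) r1 r2 o x y z s :
  c = 1 \/ c = -1 -> four_ok r1 r2 o x y z s ->
  four_move (Some @` soup_set R s)
    (Some @` soup_set R (twist_soup r1 r2 o x y z c ++
       [seq e <- s | e \notin twist_soup r1 r2 o x y z 0])).
Proof.
move=> c1 /and3P[/Z.ltb_lt d0 /allP t0s /allP out]; exists c => //.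
set t0 := twist_soup _ _ _ _ _ _ 0 in t0s out *.
set s' := [seq e <- s | _] in out *.
pose fm := grid_map (R := R) o x y z.
pose fc := grid_coord (R := R) o x y z.
have fmK : cancel fm fc by apply: frame_mapK; exact: embed_det_neq0.
have fcK : cancel fc fm by apply: frame_coordK; exact: embed_det_neq0.
exists (omap fc).
  apply: extension_homeomorphism fcK fmK; first exact: continuous_frame_coord.
  exact: continuous_frame_map.
have -> : soup_set R s = soup_set R t0 `|` soup_set R s'.
  rewrite -soup_set_cat; apply: soup_set_mem => e.
  rewrite mem_cat mem_filter; case: (boolP (e \in t0)) => //= /t0s.
  by [].
rewrite soup_set_cat !twist_soup_set -/fm.
have imE (A B : set (R3 R)) : omap fc @` (Some @` (fm @` A `|` B)) =
    Some @` (A `|` fc @` B) :> set (S3 R).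
  apply/seteqP; split=> q.
    case=> _ [p [[u Au <-]|Bp] <-] <-.
      by exists u; [left|rewrite /= fmK].
    by exists (fc p) => //; right; exists p.
  case=> u [Au|[p Bp <-]] <-.
    by exists (Some (fm u)); [exists (fm u) => //; left; exists u|rewrite /= fmK].
  by exists (Some p) => //; exists p => //; right.
rewrite !imE.
set O := fc @` _.
have twist_box k : twist_tangle R k `<=` tangle_ball R := @twist_tangle_ball R k.
have O_box k : k = 0 \/ k = 1 \/ k = -1 -> O `&` tangle_ball R `<=` twist_tangle R k.
  move=> /(twist_tangle_ends R)[e1 e2 e3 e4] _ [[p [e /out eo ep] <-] box].
  have : fc p \in _ := outside_ball d0 eo ep box; rewrite !inE => /or4P[] /eqP -> //.
have insideE k : k = 0 \/ k = 1 \/ k = -1 ->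
    (Some @` (twist_tangle R k `|` O) : set (S3 R)) `&` (Some @` tangle_ball R) =
    Some @` twist_tangle R k.
  move=> k01; rewrite predeqE => q; split.
    case=> -[u tu <-] [v vb [uv]]; rewrite uv in vb *.
    by exists u => //; case: tu => // Ou; apply: (O_box _ k01).
  by case=> u tu <-; split; exists u => //; [left|exact: twist_box tu].
split.
- by apply: insideE; left.
- by apply: insideE; right; case: c1; [left|right].
- rewrite predeqE => q; split=> -[[u [tu|Ou] <-] nb].
  + by case: nb; exists u => //; exact: twist_box tu.
  + by split=> //; exists u => //; right.
  + by case: nb; exists u => //; exact: twist_box tu.
  + by split=> //; exists u => //; right.
Qed.

(** * Lists of steps *)

(** [Ins i c] replaces the i-th edge ab by ac and cb. [Del i] removes the end c of
    the i-th edge, whose other edge is the one that starts from c. In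
    [Four p r1 r2 o x y z], p is the handedness. *)
Inductive step :=
  | Ins of nat & zpoint
  | Del of nat
  | Four of bool & bool & bool & zpoint & zpoint & zpoint & zpoint.

Definition rem_at (i : nat) (s : soup) : soup := take i s ++ drop i.+1 s.

Definition triangle_ok (a b c : zpoint) (s : soup) : bool :=
  if on_edge a b c then true else delta_free a b c s.

Definition apply_step (st : step) (s : soup) : option soup :=
  match st with
  | Ins i c =>
    if drop i s is (a, b) :: _ then
      if triangle_ok a b c (rem_at i s)
      then Some [:: (a, c), (c, b) & rem_at i s] else None
    else None
  | Del i =>
    if drop i s is (a, c) :: _ then
      let s1 := rem_at i s in
      let j := find (fun e => e.1 == c) s1 in
      if drop j s1 is (c', b) :: _ then
        if (c' == c) && triangle_ok a b c (rem_at j s1)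
        then Some ((a, b) :: rem_at j s1) else None
      else None
    else None
  | Four p r1 r2 o x y z =>
    if four_ok r1 r2 o x y z s then
      Some (twist_soup r1 r2 o x y z (if p then 1 else -1) ++
            [seq e <- s | e \notin twist_soup r1 r2 o x y z 0])
    else None
  end.

Fixpoint run (steps : seq step) (s : soup) : option soup :=
  if steps is st :: steps' then
    if apply_step st s is Some s' then run steps' s' else None
  else Some s.

Lemma rem_at_mem i (s : soup) e t : drop i s = e :: t -> s =i e :: rem_at i s.
Proof.
move=> E f; have Et : drop i.+1 s = t by rewrite -add1n -drop_drop E /= drop0.
by rewrite -{1}(cat_take_drop i s) E /rem_at Et !(mem_cat, inE) orbCA.
Qed.

Lemma triangle_isotopic (R : realType) a b c s : triangle_ok a b c s ->
  ambient_isotopic (Some @` soup_set R ((a, b) :: s) : set (S3 R))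
                   (Some @` soup_set R [:: (a, c), (c, b) & s]).
Proof.
rewrite /triangle_ok; case: ifP => [/on_edge_segment E _|_]; last exact: delta_free_isotopic.
rewrite !soup_set_cons setUA /= -E.
exists snd; last by rewrite /= image_id.
split.
- by apply: continuous_subspaceT => x; exact: cvg_snd.
- move=> t _; split; first by move=> x; exact: cvg_id.
  by exists id; split=> // x; exact: cvg_id.
- by [].
Qed.

Lemma step_reducible (R : realType) st s s' : apply_step st s = Some s' ->
  reducible_by_four_moves (Some @` soup_set R s : set (S3 R)) (Some @` soup_set R s').
Proof.
case: st => [i c|i|p r1 r2 o x y z] /=.
- case E: (drop i s) => [|[a b] t] //; case: ifP => // ok [<-].
  apply: rt_step; constructor 1; rewrite (soup_set_mem R (rem_at_mem E)).
  exact: triangle_isotopic.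
- case E: (drop i s) => [|[a c] t] //; case E': (drop _ _) => [|[c' b] t'] //.
  case: ifP => // /andP[/eqP ec ok] [<-]; rewrite ec in E'.
  apply: rt_step; constructor 1; apply: ambient_isotopic_sym.
  have -> : soup_set R s =
      soup_set R [:: (a, c), (c, b) & rem_at (find (fun e => e.1 == c) (rem_at i s)) (rem_at i s)].
    apply: soup_set_mem => f.
    by rewrite (rem_at_mem E) inE (rem_at_mem E') !inE.
  exact: triangle_isotopic.
- case: ifP => // ok [<-]; apply: rt_step; constructor 2.
  by apply: four_ok_four_move ok; case: p; [left|right].
Qed.

Lemma run_reducible (R : realType) steps s s' : run steps s = Some s' ->
  reducible_by_four_moves (Some @` soup_set R s : set (S3 R)) (Some @` soup_set R s').
Proof.
elim: steps s => [|st steps IH] s /=; first by move=> [<-]; exact: rt_refl.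
case E: (apply_step st s) => [s1|] // /IH; apply: rt_trans.
exact: step_reducible E.
Qed.

Definition unoriented (s : soup) : soup := s ++ map flip_edge s.

Definition same_soup (s s' : soup) : bool :=
  all (mem (unoriented s')) s && all (mem (unoriented s)) s'.

Lemma same_soup_set (R : realType) s s' : same_soup s s' ->
  soup_set R s = soup_set R s'.
Proof.
have uE t : soup_set R (unoriented t) = soup_set R t.
  by rewrite soup_set_cat soup_set_flip setUid.
case/andP=> /allP ss' /allP s's; apply/seteqP; split=> x [e].
  by move=> /ss' es ex; rewrite -uE; exists e.
by move=> /s's es ex; rewrite -uE; exists e.
Qed.

Definition certifies (steps : seq step) (s s' : soup) : bool :=
  if run steps s is Some t then same_soup t s' else false.

Lemma certifies_reducible (R : realType) steps s s' : certifies steps s s' ->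
  reducible_by_four_moves (Some @` soup_set R s : set (S3 R)) (Some @` soup_set R s').
Proof.
rewrite /certifies; case E: (run steps s) => [t|] // /(same_soup_set R) <-.
exact: run_reducible E.
Qed.

(** * Closed braids as polygonal links *)

Definition zpt (x y z : int) : zpoint :=
  (grid * Z_of_int x, grid * Z_of_int y, grid * Z_of_int z)%Z.

Definition letter_soup (n j : nat) (l : nat * bool) : soup :=
  let h : int := if l.2 then 1 else -1 in
  let x : int := (2 * l.1)%N in
  let y : int := (2 * j)%N in
  edges [:: zpt x y 0; zpt (x + 1) (y + 1) h; zpt (x + 2) (y + 2) 0] ++
  edges [:: zpt (x + 2) y 0; zpt (x + 1) (y + 1) (- h); zpt x (y + 2) 0] ++
  [seq (zpt (2 * k)%N y 0, zpt (2 * k)%N (y + 2) 0)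
     | k <- iota 0 n & (k != l.1) && (k != l.1.+1)].

Definition arc_soup (n N k : nat) : soup :=
  let x : int := (2 * k)%N in
  let x' : int := (2 * (2 * n - k))%N in
  let y : int := (2 * N)%N in
  let d : int := (2 * (n - k))%N in
  edges [:: zpt x y 0; zpt x (y + d) 0; zpt x' (y + d) 0;
            zpt x' (- d) 0; zpt x (- d) 0; zpt x 0 0].

Definition braid_soup (n : nat) (w : seq (nat * bool)) : soup :=
  flatten [seq letter_soup n j (nth (0%N, true) w j) | j <- iota 0 (size w)] ++
  flatten [seq arc_soup n (size w) k | k <- iota 0 n].

Lemma embed_zpt (R : realType) x y z : embed R (zpt x y z) = pt R x y z.
Proof.
have g0 : real_of R grid != 0 by rewrite real_of_grid.
by rewrite /embed /zpt !real_ofM !real_of_int ![real_of R grid * _]mulrC !mulfK.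
Qed.

Lemma soup_set_flatten (R : realType) (f : nat -> soup) n :
  soup_set R (flatten [seq f j | j <- iota 0 n]) =
  \bigcup_(j in [set j | (j < n)%N]) soup_set R (f j).
Proof.
apply/seteqP; split=> x.
  case=> e /flatten_mapP[j]; rewrite mem_iota /= => jn ej ex.
  by exists j => //; exists e.
case=> j /= jn [e ej ex]; exists e => //; apply/flatten_mapP; exists j => //.
by rewrite mem_iota.
Qed.

Lemma letter_soup_set (R : realType) n j l :
  soup_set R (letter_soup n j l) = braid_letter R n j l.
Proof.
rewrite /letter_soup /braid_letter !soup_set_cat !soup_set_edges // setUA.
rewrite ![map _ _]/= !embed_zpt; congr (_ `|` _ `|` _).
apply/seteqP; split=> x.
  case=> e /mapP[k]; rewrite mem_filter mem_iota => /andP[/andP[/eqP k1 /eqP k2] kn] -> /=.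
  by rewrite !embed_zpt => xk; exists k.
case=> k /= [kn /eqP k1 /eqP k2] xk.
exists (zpt (2 * k)%N (2 * j)%N 0, zpt (2 * k)%N ((2 * j)%N%:Z + 2) 0).
  by apply/mapP; exists k; rewrite // mem_filter k1 k2 mem_iota.
by rewrite /= !embed_zpt.
Qed.

Lemma closed_braid_soup (R : realType) n w :
  closed_braid R n w = Some @` soup_set R (braid_soup n w).
Proof.
rewrite /closed_braid /braid_soup soup_set_cat !soup_set_flatten; congr (_ @` (_ `|` _)).
  by apply: eq_bigcupr => j _; rewrite letter_soup_set.
apply: eq_bigcupr => k _.
by rewrite /arc_soup soup_set_edges // [map _ _]/= !embed_zpt.
Qed.

(** * An explicit reduction *)

Local Open Scope Z_scope.

(** Each stage but the last ends with a 4-move. Before it, the edges of the link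
    are deformed such that two of them become the straight strands of a small
    parallelepiped, and these are divided into eight parts as in the tangle of
    the move. The last stage deforms the resulting Hopf link into the closed
    braid of two crossings. *)
Definition stage1 : seq step := [::
  Del 1; Del 5; Del 9; Del 11; Del 21; Del 25; Del 29; Del 31; Del 41; Del 45;
  Del 49; Del 51; Del 58; Del 59; Del 72; Del 76; Del 13; Del 11; Del 11; Del 9;
  Del 9; Del 5; Ins 31 (143,399,-33); Ins 1 (143,399,-25); Ins 28 (163,347,-29);
  Ins 1 (163,347,-21); Ins 3 (143,399,-32); Ins 1 (143,399,-31);
  Ins 1 (143,399,-30); Ins 1 (143,399,-29); Ins 1 (143,399,-28);
  Ins 1 (143,399,-27); Ins 1 (143,399,-26); Ins 8 (163,347,-28);
  Ins 1 (163,347,-27); Ins 1 (163,347,-26); Ins 1 (163,347,-25);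
  Ins 1 (163,347,-24); Ins 1 (163,347,-23); Ins 1 (163,347,-22);
  Four true false false (153,373,-31) (-10,26,-2) (-1,0,0) (0,0,1)].

Definition stage2 : seq step := [::
  Del 66; Ins 81 (464,1020,-7); Del 82; Del 81; Del 72; Del 84; Del 20; Del 78;
  Del 81; Del 54; Del 20; Ins 74 (548,1194,7); Del 75; Del 33; Del 56;
  Ins 10 (84,807,3); Del 65; Del 64; Ins 68 (91,1204,-11); Del 31; Del 62;
  Del 21; Del 40; Del 40; Del 51; Del 42; Del 2; Del 39; Del 35; Del 48; Del 16;
  Del 39; Del 61; Ins 57 (658,1265,35); Del 14; Del 1; Ins 43 (139,161,-3);
  Del 43; Del 13; Del 35; Del 37; Ins 45 (213,638,57); Del 41; Del 1; Del 43;
  Ins 24 (147,490,8); Del 19; Del 35; Del 23; Del 2; Ins 48 (120,845,38);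
  Del 49; Del 48; Ins 7 (114,554,-7); Del 18; Del 44; Ins 22 (33,677,-15);
  Del 46; Del 6; Del 28; Del 18; Ins 0 (326,915,-8); Del 49; Del 48; Del 38;
  Del 28; Del 27; Del 39; Del 34; Del 12; Del 19; Del 13; Ins 22 (119,118,10);
  Del 35; Del 1; Del 31; Del 6; Del 28; Del 29; Ins 4 (119,126,20); Del 6;
  Del 1; Ins 4 (91,269,1); Del 32; Del 1; Ins 3 (165,42,-34); Del 25; Del 12;
  Del 30; Del 30; Ins 29 (33,-134,-56); Ins 30 (95,850,4); Ins 19 (129,924,-8);
  Ins 1 (105,932,-8); Ins 29 (187,1088,-2); Ins 1 (211,1080,-2);
  Ins 3 (126,925,-8); Ins 1 (123,926,-8); Ins 1 (120,927,-8);
  Ins 1 (117,928,-8); Ins 1 (114,929,-8); Ins 1 (111,930,-8);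
  Ins 1 (108,931,-8); Ins 8 (190,1087,-2); Ins 1 (193,1086,-2);
  Ins 1 (196,1085,-2); Ins 1 (199,1084,-2); Ins 1 (202,1083,-2);
  Ins 1 (205,1082,-2); Ins 1 (208,1081,-2);
  Four true false true (170,1002,-5) (-41,-78,-3) (0,0,3) (-3,1,0)].

Definition stage3 : seq step := [::
  Del 15; Ins 37 (283,824,-6); Del 26; Del 48; Del 6; Del 7; Del 40;
  Ins 19 (21,694,-24); Del 35; Del 33; Del 41; Del 25; Del 14; Del 21; Del 20;
  Del 16; Del 6; Del 13; Del 14; Ins 15 (194,1110,-54); Del 6; Del 14; Del 11;
  Del 4; Ins 4 (57,690,-18); Del 9; Del 22; Del 6; Del 3; Del 0; Del 2;
  Ins 11 (58,-209,-22); Del 24; Del 1; Del 8; Del 3; Ins 12 (186,523,-39);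
  Ins 1 (202,515,-23); Ins 4 (198,565,-31); Ins 1 (214,557,-15);
  Ins 3 (188,522,-37); Ins 1 (190,521,-35); Ins 1 (192,520,-33);
  Ins 1 (194,519,-31); Ins 1 (196,518,-29); Ins 1 (198,517,-27);
  Ins 1 (200,516,-25); Ins 8 (200,564,-29); Ins 1 (202,563,-27);
  Ins 1 (204,562,-25); Ins 1 (206,561,-23); Ins 1 (208,560,-21);
  Ins 1 (210,559,-19); Ins 1 (212,558,-17);
  Four false false false (192,544,-35) (-6,-21,-4) (2,0,-2) (2,-1,2)].

Definition stage4 : seq step := [::
  Del 15; Ins 21 (595,1165,-42); Del 29; Del 28; Ins 1 (547,1071,-28); Del 2;
  Del 36; Del 33; Del 5; Del 9; Del 2; Del 13; Del 10; Ins 24 (174,116,-19);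
  Del 17; Del 5; Del 15; Del 14; Ins 3 (174,191,-25); Del 4; Del 11; Del 9;
  Del 10; Ins 24 (148,150,-12); Del 20; Del 25; Ins 8 (207,555,-24); Del 4;
  Del 1; Ins 8 (198,617,46); Del 23; Del 1; Ins 11 (294,513,-24);
  Ins 1 (270,505,-24); Ins 12 (270,599,-22); Ins 1 (246,591,-22);
  Ins 3 (291,512,-24); Ins 1 (288,511,-24); Ins 1 (285,510,-24);
  Ins 1 (282,509,-24); Ins 1 (279,508,-24); Ins 1 (276,507,-24);
  Ins 1 (273,506,-24); Ins 8 (267,598,-22); Ins 1 (264,597,-22);
  Ins 1 (261,596,-22); Ins 1 (258,595,-22); Ins 1 (255,594,-22);
  Ins 1 (252,593,-22); Ins 1 (249,592,-22);
  Four true false false (282,556,-23) (12,-43,-1) (0,0,3) (-3,-1,0)].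

Definition stage5 : seq step := [::
  Ins 34 (54,339,19); Del 33; Del 12; Del 30; Del 0; Del 11; Del 1;
  Ins 5 (294,594,-33); Del 2; Del 35; Del 13; Del 9; Ins 20 (632,1243,36);
  Del 28; Del 26; Del 28; Ins 14 (289,521,-23); Del 10; Del 9; Del 0;
  Ins 22 (204,495,25); Del 23; Ins 2 (209,661,-26); Del 4; Del 29; Del 9; Del 0;
  Del 26; Ins 15 (224,562,-78); Del 14; Del 9; Ins 6 (185,500,65); Del 7; Del 1;
  Ins 8 (458,980,19); Ins 1 (458,956,19); Ins 10 (398,956,13);
  Ins 1 (398,980,13); Ins 3 (458,977,19); Ins 1 (458,974,19);
  Ins 1 (458,971,19); Ins 1 (458,968,19); Ins 1 (458,965,19);
  Ins 1 (458,962,19); Ins 1 (458,959,19); Ins 8 (398,959,13);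
  Ins 1 (398,962,13); Ins 1 (398,965,13); Ins 1 (398,968,13);
  Ins 1 (398,971,13); Ins 1 (398,974,13); Ins 1 (398,977,13);
  Four false false true (428,980,16) (30,0,3) (0,0,3) (0,-3,0)].

Definition stage6 : seq step := [::
  Del 5; Del 11; Ins 7 (418,965,27); Del 3; Del 1; Del 3; Ins 3 (440,960,25);
  Del 11; Del 11; Ins 5 (452,981,18); Del 4; Del 14; Ins 17 (105,104,-32);
  Ins 1 (105,96,-32); Ins 25 (79,78,-16); Ins 1 (79,86,-16);
  Ins 3 (105,103,-32); Ins 1 (105,102,-32); Ins 1 (105,101,-32);
  Ins 1 (105,100,-32); Ins 1 (105,99,-32); Ins 1 (105,98,-32);
  Ins 1 (105,97,-32); Ins 8 (79,79,-16); Ins 1 (79,80,-16); Ins 1 (79,81,-16);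
  Ins 1 (79,82,-16); Ins 1 (79,83,-16); Ins 1 (79,84,-16); Ins 1 (79,85,-16);
  Four false false true (92,95,-24) (13,9,-8) (1,0,1) (0,-1,0)].

Definition stage7 : seq step := [::
  Del 9; Del 20; Del 17; Del 9; Del 28; Del 25; Del 1; Del 26;
  Ins 19 (212,501,-65); Del 29; Del 1; Del 14; Ins 11 (90,94,-14); Del 12;
  Del 1; Del 29; Del 11; Ins 40 (129,207,28); Del 38; Del 22; Del 12; Del 21;
  Del 17; Del 14; Del 16; Del 0; Del 18; Del 3; Del 1; Ins 14 (420,973,21);
  Del 15; Del 1; Del 7; Del 2; Ins 1 (139,139,10); Del 7; Del 11;
  Ins 6 (306,497,-65); Del 20; Del 17; Del 4; Del 11; Ins 18 (134,603,-1);
  Ins 1 (150,619,7); Ins 25 (120,631,-19); Ins 1 (136,647,-11);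
  Ins 3 (136,605,0); Ins 1 (138,607,1); Ins 1 (140,609,2); Ins 1 (142,611,3);
  Ins 1 (144,613,4); Ins 1 (146,615,5); Ins 1 (148,617,6); Ins 8 (122,633,-18);
  Ins 1 (124,635,-17); Ins 1 (126,637,-16); Ins 1 (128,639,-15);
  Ins 1 (130,641,-14); Ins 1 (132,643,-13); Ins 1 (134,645,-12);
  Four true false false (127,617,-10) (7,-14,9) (2,-1,-2) (2,2,1)].

Definition stage8 : seq step := [::
  Del 9; Ins 34 (104,764,-85); Del 17; Del 16; Ins 5 (128,649,-64); Del 6;
  Del 5; Del 32; Del 14; Ins 22 (106,102,-23); Del 23; Del 1;
  Ins 19 (128,517,-8); Del 36; Del 1; Ins 31 (182,612,31); Del 21; Del 16;
  Ins 19 (90,280,2); Del 24; Del 1; Del 15; Ins 4 (191,615,33); Del 5; Del 16;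
  Del 8; Ins 8 (137,643,3); Del 17; Del 16; Ins 13 (154,684,-55); Del 14; Del 4;
  Ins 20 (199,471,-57); Del 14; Del 1; Del 0; Ins 11 (91,561,-9); Del 13;
  Ins 10 (144,624,-8); Del 16; Del 8; Del 11; Ins 10 (181,694,4);
  Ins 1 (189,694,4); Ins 16 (211,764,0); Ins 1 (219,764,0); Ins 3 (182,694,4);
  Ins 1 (183,694,4); Ins 1 (184,694,4); Ins 1 (185,694,4); Ins 1 (186,694,4);
  Ins 1 (187,694,4); Ins 1 (188,694,4); Ins 8 (212,764,0); Ins 1 (213,764,0);
  Ins 1 (214,764,0); Ins 1 (215,764,0); Ins 1 (216,764,0); Ins 1 (217,764,0);
  Ins 1 (218,764,0);
  Four false false false (196,729,2) (-15,-35,2) (0,0,-1) (1,0,0)].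

Definition stage9 : seq step := [::
  Del 14; Del 18; Del 9; Del 3; Del 9; Del 4; Del 5; Del 10; Ins 8 (191,725,-3);
  Del 9; Del 1; Ins 22 (296,738,2); Del 4; Del 10; Del 16; Del 0;
  Ins 18 (135,606,-121); Ins 24 (185,419,33); Ins 1 (185,419,25);
  Ins 7 (221,539,19); Ins 1 (221,539,11); Ins 3 (185,419,32);
  Ins 1 (185,419,31); Ins 1 (185,419,30); Ins 1 (185,419,29);
  Ins 1 (185,419,28); Ins 1 (185,419,27); Ins 1 (185,419,26);
  Ins 8 (221,539,18); Ins 1 (221,539,17); Ins 1 (221,539,16);
  Ins 1 (221,539,15); Ins 1 (221,539,14); Ins 1 (221,539,13);
  Ins 1 (221,539,12);
  Four true false false (203,479,26) (-18,-60,7) (-1,0,0) (0,0,-1)].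

Definition stage10 : seq step := [::
  Del 8; Ins 37 (304,600,-26); Del 39; Del 22; Del 8; Del 11; Del 14; Del 7;
  Ins 38 (128,134,16); Del 17; Del 12; Del 5; Del 18; Ins 15 (214,472,101);
  Del 36; Del 1; Ins 12 (241,403,46); Del 13; Del 15; Del 4; Ins 6 (146,281,16);
  Del 7; Ins 4 (204,466,25); Del 8; Del 1; Ins 7 (159,530,57); Del 12; Del 11;
  Del 3; Ins 27 (190,632,8); Del 15; Del 15; Del 0; Del 1; Ins 9 (302,602,-29);
  Del 10; Ins 26 (366,453,-85); Del 27; Ins 21 (127,626,-19); Del 31; Del 1;
  Ins 3 (319,489,-75); Del 4; Ins 9 (146,586,9); Del 10; Del 13;
  Ins 20 (199,728,5); Del 18; Del 1; Ins 24 (182,446,-78); Del 11; Del 20;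
  Ins 2 (175,459,-58); Del 3; Ins 2 (97,672,-26); Del 23; Ins 2 (279,581,-43);
  Del 13; Ins 0 (173,594,-76); Del 19; Ins 22 (125,613,-21); Del 23;
  Ins 2 (146,628,-14); Ins 1 (162,636,-30); Ins 16 (146,642,-6);
  Ins 1 (162,650,-22); Ins 3 (148,629,-16); Ins 1 (150,630,-18);
  Ins 1 (152,631,-20); Ins 1 (154,632,-22); Ins 1 (156,633,-24);
  Ins 1 (158,634,-26); Ins 1 (160,635,-28); Ins 8 (148,643,-8);
  Ins 1 (150,644,-10); Ins 1 (152,645,-12); Ins 1 (154,646,-14);
  Ins 1 (156,647,-16); Ins 1 (158,648,-18); Ins 1 (160,649,-20);
  Four false false false (146,635,-10) (0,-7,-4) (-2,1,-2) (2,1,-2)].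

Definition stage11 : seq step := [::
  Del 15; Del 13; Del 4; Del 13; Del 13; Del 4; Del 7; Ins 12 (135,625,4);
  Del 15; Del 1; Del 3; Ins 4 (166,640,-23); Del 9; Ins 16 (91,689,-8); Del 17;
  Ins 10 (180,644,-20); Ins 4 (172,665,-22); Ins 1 (151,657,-20);
  Ins 1 (151,649,-20); Ins 6 (133,651,-14); Ins 1 (133,659,-14);
  Ins 3 (151,656,-20); Ins 1 (151,655,-20); Ins 1 (151,654,-20);
  Ins 1 (151,653,-20); Ins 1 (151,652,-20); Ins 1 (151,651,-20);
  Ins 1 (151,650,-20); Ins 8 (133,652,-14); Ins 1 (133,653,-14);
  Ins 1 (133,654,-14); Ins 1 (133,655,-14); Ins 1 (133,656,-14);
  Ins 1 (133,657,-14); Ins 1 (133,658,-14);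
  Four true false true (142,658,-17) (9,-1,-3) (0,0,1) (0,-1,0)].

Definition stage12 : seq step := [::
  Del 26; Del 6; Del 8; Del 12; Del 16; Del 10; Del 27; Del 37;
  Ins 19 (156,628,-31); Del 27; Del 1; Del 19; Ins 2 (155,629,-16); Del 24;
  Del 1; Del 19; Del 18; Del 1; Del 14; Del 4; Del 37; Del 9; Del 5; Del 9;
  Ins 8 (150,644,-26); Del 12; Del 3; Del 9; Del 11; Ins 26 (196,393,33);
  Del 28; Del 1; Del 27; Ins 19 (186,696,-11); Del 6; Del 11;
  Ins 1 (183,687,-7); Del 2; Ins 9 (49,339,46); Del 18; Ins 3 (180,692,-20);
  Del 4; Ins 24 (87,297,-10); Del 25; Ins 9 (157,658,-41); Del 16;
  Ins 24 (270,507,-72); Del 25; Ins 5 (155,376,-26); Del 6; Ins 1 (144,430,-32);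
  Del 2; Ins 20 (100,627,-122); Del 17; Del 20; Ins 11 (149,449,-58); Del 21;
  Ins 14 (109,541,1); Del 27; Ins 13 (151,677,-3); Del 19; Ins 12 (288,529,-72);
  Del 13; Ins 17 (196,412,36); Del 19; Ins 1 (195,444,24); Del 2;
  Ins 18 (-18,288,92); Del 11; Ins 17 (147,644,-40); Del 18;
  Ins 17 (121,464,-83); Del 18; Del 1; Del 16; Del 1; Del 14; Del 1;
  Ins 4 (100,590,-75); Del 5; Ins 8 (191,460,31); Del 9; Ins 1 (188,465,24);
  Del 2; Ins 3 (139,631,-53); Del 4; Ins 13 (123,605,-18); Del 5;
  Ins 16 (163,629,-10); Del 3; Ins 22 (189,737,45); Del 6; Del 5; Del 12;
  Ins 13 (175,370,22); Del 22; Ins 4 (135,733,40); Del 5; Ins 3 (189,373,7);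
  Del 4; Ins 8 (202,483,16); Del 21; Ins 5 (161,707,39); Del 6;
  Ins 1 (183,675,13); Del 2; Ins 14 (121,491,20); Del 15; Ins 16 (138,515,9);
  Del 9; Ins 10 (130,575,-12); Del 13; Ins 2 (206,418,7); Del 11;
  Ins 4 (188,461,33); Del 3; Ins 2 (251,574,18); Del 14; Del 1; Del 17;
  Ins 1 (276,587,75); Del 3; Ins 19 (200,545,-33); Del 19; Ins 9 (123,522,16);
  Del 10; Ins 15 (155,603,6); Del 11; Ins 0 (143,558,-4); Del 11;
  Ins 1 (151,557,-1); Del 2; Ins 1 (162,542,6); Del 2; Del 1; Del 1;
  Ins 2 (112,518,-15); Del 3; Ins 1 (121,521,-25); Del 2; Ins 10 (180,686,11);
  Del 11; Del 3; Ins 4 (205,715,6); Del 13; Ins 4 (155,418,-61); Del 10;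
  Ins 9 (217,596,25); Del 10; Ins 9 (244,588,19); Del 7; Ins 3 (213,569,16);
  Del 4; Ins 3 (224,546,50); Del 4; Del 16; Del 4; Del 3; Ins 8 (126,540,-23);
  Del 8; Ins 5 (187,663,-39); Del 9; Ins 1 (206,721,-4); Del 2;
  Ins 1 (191,664,7); Del 2; Del 11; Ins 5 (189,580,10); Del 4;
  Ins 8 (103,503,-93); Del 3; Ins 0 (157,574,-22); Del 3; Del 5;
  Ins 2 (162,585,-19); Del 3; Del 5; Del 7; Ins 6 (208,629,7); Del 8; Del 2;
  Del 7; Del 7; Del 6; Ins 4 (287,264,-2); Del 5; Ins 3 (-13,149,73); Del 6;
  Ins 2 (80,80,0); Del 5; Ins 2 (80,0,0); Del 6; Ins 2 (40,40,40); Del 6;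
  Ins 2 (240,240,0); Del 6; Ins 1 (240,-80,0); Ins 2 (80,160,0);
  Ins 1 (80,240,0); Ins 5 (320,-160,0); Ins 1 (0,0,0); Ins 10 (0,320,0);
  Ins 1 (320,320,0); Del 1; Ins 2 (40,120,-40); Ins 12 (40,40,-40);
  Ins 1 (40,120,40); Del 1; Ins 1 (0,80,0); Ins 5 (0,160,0); Ins 9 (0,-160,0);
  Ins 15 (80,-80,0)].

Definition reduction : seq step :=
  stage1 ++ stage2 ++ stage3 ++ stage4 ++ stage5 ++ stage6 ++
  stage7 ++ stage8 ++ stage9 ++ stage10 ++ stage11 ++ stage12.

Local Close Scope Z_scope.

Lemma reduction_certifies :
  certifies reduction (braid_soup 4 (nine_star_word [:: 1; 2; 1; 1; 2; 1; 1; 2; 1]%N))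
    (braid_soup 2 [:: (0, true); (0, true)]%N).
Proof. by vm_compute. Qed.

Theorem mainTheorem2 (R : realType) :
  reducible_by_four_moves (link_12_2_Jab R) (Hopf_link R).
Proof.
rewrite /link_12_2_Jab /Hopf_link !closed_braid_soup.
exact: certifies_reducible reduction_certifies.
Qed.
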